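(* Let $\mathscr{C}$ be a spacelike cone contained in $(\mathscr{S}_a+x)'$ for some $x\in\mathbb{M}^3$, let $\eta \in \Delta_{\mathrm{BF}}^{\mathfrak{A}}(\mathscr{C})$, and let $\rho \in \Delta_{\mathrm{DHR}}^{\mathfrak{A}}(\mathcal{O})$ for some double cone $\mathcal{O} \subset \mathscr{S}_a'$. Then the DHR sectors are degenerate with respect to the braiding, i.e. $$\varepsilon_{\rho,\eta} \circ \varepsilon_{\eta,\rho} = I_{\eta\otimes\rho}.$$
   Context: $\mathbb{M}^3$ is 3-dimensional Minkowski space. For a region $\mathscr{S}$, $\mathscr{S}'$ is its causal (spacelike) complement; for a set of operators, a prime denotes the commutant. A spacelike cone is a set $\mathscr{C}=x+\bigcup_{\lambda>0}\lambda\cdot\mathcal{O}$ with $\mathcal{O}$ a double cone not containing the origin, $x\in\mathbb{M}^3$, and $\mathscr{C}=\mathscr{C}''$. All representations and endomorphisms are unital and $*$-preserving. Observable net: $\mathcal{O}\mapsto\mathfrak{A}(\mathcal{O})$ assigns to each double cone a von Neumann algebra on a Hilbert space $\mathcal{H}_0$ (we work in the vacuum representation $\pi_0$, which is faithful and identified with the identity), different from $\mathbb{C}I$, such that: isotony holds; algebras of spacelike separated double cones commute; there is a strongly continuous unitary representation $\mathcal{U}_0$ of the translation group with $\mathcal{U}_0(x)\mathfrak{A}(\mathcal{O})\mathcal{U}_0(x)^*=\mathfrak{A}(\mathcal{O}+x)$, joint spectrum of the generators in the closed forward light cone, and an up to phase unique invariant unit vector $\Omega$. $\mathfrak{A}$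 (quasi-local algebra) is the norm closure of $\bigcup_{\mathcal{O}}\mathfrak{A}(\mathcal{O})$ and acts irreducibly. For an unbounded region $\mathscr{S}$, $\mathfrak{A}(\mathscr{S})$ is the norm closure of $\bigcup_{\mathcal{O}\subset\mathscr{S}}\mathfrak{A}(\mathcal{O})$. Haag duality: $\mathfrak{A}(\mathscr{S}')'=\mathfrak{A}(\mathscr{S})''$ for $\mathscr{S}$ a double cone or a spacelike cone. BF representations: a BF representation is a representation $\eta$ of $\mathfrak{A}$ such that for every spacelike cone $\widehat{\mathscr{C}}$ the restrictions $\eta\upharpoonright\mathfrak{A}(\widehat{\mathscr{C}}')$ and $\pi_0\upharpoonright\mathfrak{A}(\widehat{\mathscr{C}}')$ are unitarily equivalent. It is localised in $\mathscr{C}$ if it acts on $\mathcal{H}_0$ and $\eta(A)=A$ for $A\in\mathfrak{A}(\mathscr{C}')$. Fix an auxiliary spacelike cone $\mathscr{S}_a$ and let $\mathfrak{A}^{\mathscr{S}_a}$ be the norm closure of $\bigcup_{x\in\mathbb{M}^3}\mathfrak{A}((\mathscr{S}_a+x)')''$. Each BF representation $\eta$ has a unique extension $\eta^{\mathscr{S}_a}$ to $\mathfrak{A}^{\mathscr{S}_a}$ that is weakly continuous on each $\mathfrak{A}((\mathscr{S}_a+x)')''$; it is an endomorphism of $\mathfrak{A}^{\mathscr{S}_a}$ if $\eta$ is localised in a cone contained in some $(\mathscr{S}_a+x)'$. $\Delta_{\mathrm{BF}}^{\mathfrak{A}}(\mathscr{C})$ is the category of BF representations localised in $\mathscr{C}$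 with finite statistical dimension (equivalently, possessing a conjugate), with intertwiners as morphisms: $T\in\operatorname{Hom}_{\mathfrak{A}}(\eta_1,\eta_2)$ iff $T\eta_1(A)=\eta_2(A)T$ for all $A\in\mathfrak{A}$. Tensor product: $\eta_1\otimes\eta_2=\eta_1^{\mathscr{S}_a}\circ\eta_2$, and $T_1\otimes T_2=T_1\eta_1^{\mathscr{S}_a}(T_2)$ for $T_i\in\operatorname{Hom}_{\mathfrak{A}}(\eta_i,\sigma_i)$. DHR: $\Delta_{\mathrm{DHR}}^{\mathfrak{A}}(\mathcal{O})$ consists of endomorphisms $\rho$ of $\mathfrak{A}$ (with finite statistical dimension) that act trivially on $\mathfrak{A}(\mathcal{O}')$ and are transportable: for every double cone $\widehat{\mathcal{O}}$ there is a unitarily equivalent endomorphism acting trivially on $\mathfrak{A}(\widehat{\mathcal{O}}')$. Each such $\rho$ is in particular a BF representation. Braiding: for BF representations $\eta_1,\eta_2$ (each localised in a spacelike cone contained in some $(\mathscr{S}_a+x)'$), choose spacelike separated spacelike cones $\widehat{\mathscr{C}}_2<\widehat{\mathscr{C}}_1$ in the causal complement of $\mathscr{S}_a+x$ for some $x$, BF representations $\widehat\eta_i\cong\eta_i$ localised in $\widehat{\mathscr{C}}_i$, and unitary intertwiners $V_i\in\operatorname{Hom}_{\mathfrak{A}}(\eta_i,\widehat\eta_i)$ in $\mathfrak{A}^{\mathscr{S}_a}$; then $\varepsilon_{\eta_1,\eta_2}=(V_2\otimes V_1)^*\circ(V_1\otimes V_2)\in\operatorname{Hom}_{\mathfrak{A}}(\eta_1\otimes\eta_2,\eta_2\otimes\eta_1)$,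 independent of these choices. Here, for spacelike separated cones, $\mathscr{C}_1<\mathscr{C}_2$ means that $\mathscr{C}_1$ can be moved to $\mathscr{S}_a$ by translations and counter-clockwise rotation of the spatial coordinates while remaining in the spacelike complement of $\mathscr{C}_2$. *)

(* Defs.v *)
From HB Require Import structures.
From mathcomp Require Import all_boot all_order all_algebra.
From mathcomp Require Import sesquilinear complex.
From mathcomp Require Import all_classical all_reals all_analysis.

Set Implicit Arguments.
Unset Strict Implicit.
Unset Printing Implicit Defensive.

Import Order.TTheory GRing.Theory Num.Theory.
Import numFieldNormedType.Exports.

Local Open Scope classical_set_scope.
Local Open Scope ring_scope.

(** * Minkowski space *)

Section Minkowski.
Context {R : realType}.

(* (t, x1, x2) *)
Definition Mink : Type := (R^o * R^o * R^o)%type.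

Implicit Types (x y p : Mink) (S C O : set Mink).

Definition mink x y : R := x.1.1 * y.1.1 - x.1.2 * y.1.2 - x.2 * y.2.

Definition forward_cone : set Mink := [set x | 0 < x.1.1 /\ 0 < mink x x].

Definition closed_forward_cone : set Mink :=
  [set x | 0 <= x.1.1 /\ 0 <= mink x x].

Definition causal_compl S : set Mink :=
  [set y | forall x, S x -> mink (y - x) (y - x) < 0].

Definition translate S x : set Mink := [set y + x | y in S].

Definition double_cone O : Prop := exists a b : Mink,
  forward_cone (b - a) /\
  O = [set y | forward_cone (y - a) /\ forward_cone (b - y)].

Definition spacelike_cone C : Prop := exists (x : Mink) (O : set Mink),
  [/\ double_cone O, ~ O 0,
      C = [set x + l *: y | l in [set l : R | 0 < l] & y in O]
    & causal_compl (causal_compl C) = C].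

Definition rot (th : R) x : Mink :=
  (x.1.1, cos th * x.1.2 - sin th * x.2, sin th * x.1.2 + cos th * x.2).

(* The order on spacelike separated cones, relative to the auxiliary cone Sa.
   The motion at time s is y |-> rot (th s) y + a s; it is counter-clockwise
   because th is nondecreasing.  "Moved to Sa" means: moved into Sa. *)
Definition cone_lt (Sa C1 C2 : set Mink) : Prop :=
  C1 `<=` causal_compl C2 /\
  exists (th : R -> R) (a : R -> Mink),
    [/\ {within `[0, 1], continuous th} /\ {within `[0, 1], continuous a},
        {in `[0, 1] &, {homo th : s t / s <= t}},
        th 0 = 0 /\ a 0 = 0,
        forall s, s \in `[0, 1] ->
          [set rot (th s) y + a s | y in C1] `<=` causal_compl C2
      & [set rot (th 1) y + a 1 | y in C1] `<=` Sa].

End Minkowski.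
Arguments Mink : clear implicits.

(** * Operators on a Hilbert space *)

(* The dot form is linear in its first argument. *)
Record hilbert (R : realType) := Hilbert {
  hsort :> completeNormedModType R[i];
  hdot : {dot hsort for Num.conj};
  hnormE : forall u : hsort, `|u| ^+ 2 = hdot u u }.

Notation "'[ u , v ]" := (hdot _ u v) : ring_scope.

Section Operators.
Context {R : realType} {H : hilbert R}.

Local Notation op := (H -> H).
Implicit Types (A B T U V : op) (S M : set op) (u v : H).

Definition bounded_op A : Prop :=
  linear A /\ exists c : R[i], forall u, `|A u| <= c * `|u|.

(* The adjoint, which exists for every bounded operator by Riesz's theorem. *)
Definition adj A : op :=
  xget (fun=> 0) [set B | bounded_op B /\ forall u v, '[A u, v] = '[u, B v]].

Definition unitary_op U : Prop :=
  [/\ bounded_op U, adj U \o U = id & U \o adj U = id].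

Definition commutant S : set op :=
  [set T | bounded_op T /\ forall A, S A -> T \o A = A \o T].

Definition von_neumann_algebra M : Prop :=
  (forall A, M A -> M (adj A)) /\ commutant (commutant M) = M.

Definition norm_closure S : set op :=
  [set T | bounded_op T /\ forall e : R[i], 0 < e ->
    exists2 A, S A & forall u, `|T u - A u| <= e * `|u|].

Definition irreducible S : Prop := forall K : set H,
  closed K -> K 0 -> (forall (c : R[i]) u v, K u -> K v -> K (c *: u + v)) ->
  (forall A u, S A -> K u -> K (A u)) ->
  K = [set 0] \/ K = setT.

(* [S] is meant to be a unital *-algebra of operators on [H]; all the
   representations needed here act on [H] itself, and their values outside [S]
   are irrelevant. *)
Record representation S (pi : op -> op) : Prop := {
  repr_bounded : forall A, S A -> bounded_op (pi A);
  repr_linear : forall (c : R[i]) A B, S A -> S B ->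
    pi (c *: A + B) = c *: pi A + pi B;
  repr_mul : forall A B, S A -> S B -> pi (A \o B) = pi A \o pi B;
  repr_adj : forall A, S A -> pi (adj A) = adj (pi A);
  repr_unit : pi id = id }.

Definition unitarily_equivalent S (pi1 pi2 : op -> op) : Prop :=
  exists2 V, unitary_op V & forall A, S A -> V \o pi1 A = pi2 A \o V.

(* Continuity on M for the weak operator topology on source and target. *)
Definition weakly_continuous_on M (E : op -> op) : Prop :=
  forall A u v (e : R[i]), M A -> 0 < e ->
  exists (s : seq (H * H)) (d : R[i]), 0 < d /\
    forall B, M B ->
      (forall w, w \in s -> `|'[B w.1 - A w.1, w.2]| < d) ->
      `|'[E B u - E A u, v]| < e.

End Operators.

(** * Spectrum of the translations *)

Section Spectrum.
Context {R : realType} {H : hilbert R}.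
Implicit Types (U : Mink R -> H -> H) (P : set (Mink R) -> H -> H).

Record projection_valued_measure P : Prop := {
  pvm_bounded : forall B, measurable B -> bounded_op (P B);
  pvm_idem : forall B, measurable B -> P B \o P B = P B;
  pvm_adj : forall B, measurable B -> adj (P B) = P B;
  pvm_setT : P setT = id;
  pvm_additive : forall F : (set (Mink R))^nat,
    (forall n, measurable (F n)) -> trivIset setT F ->
    forall u, (\sum_(0 <= k < n) P (F k) u) @[n --> \oo]
                --> P (\bigcup_n F n) u }.

(* P is the joint spectral measure of the generators of U, i.e.
   U x = \int exp (i p.x) dP(p), p.x being the Minkowski product. *)
Definition spectral_measure_of U P : Prop :=
  projection_valued_measure P /\
  forall u, exists mu : {measure set (Mink R) -> \bar R},
    (forall B, measurable B -> mu B = (complex.Re '[P B u, u])%:E) /\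
    forall x, '[U x u, u] = ((\int[mu]_p cos (mink p x))%R
                      +i* (\int[mu]_p sin (mink p x))%R)%C.

Definition spectral_support P : set (Mink R) :=
  [set p | forall N, open N -> N p -> P N <> (fun=> 0)].

Record translation_rep U : Prop := {
  trans_unitary : forall x, unitary_op (U x);
  trans_add : forall x y, U (x + y) = U x \o U y;
  trans_continuous : forall u, continuous (U ^~ u) }.

End Spectrum.

(** * Observable net *)

Section Net.
Context {R : realType} {H : hilbert R}.

Local Notation op := (H -> H).
Local Notation region := (set (Mink R)).

(* Only the values of [A] on double cones matter. *)
Implicit Types (A : region -> set op) (S Sa C O : region).

(* For S an arbitrary region. *)
Definition alg A S : set op :=
  norm_closure (\bigcup_(O in [set O | double_cone O /\ O `<=` S]) A O).

Definition quasilocal A : set op := alg A setT.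

Record observable_net A (U : Mink R -> op) (Omega : H) : Prop := {
  net_vN : forall O, double_cone O -> von_neumann_algebra (A O);
  net_nontrivial : forall O, double_cone O ->
    A O <> [set T | exists c : R[i], T = ( *:%R c)];
  net_isotony : forall O1 O2, double_cone O1 -> double_cone O2 ->
    O1 `<=` O2 -> A O1 `<=` A O2;
  net_locality : forall O1 O2, double_cone O1 -> double_cone O2 ->
    O1 `<=` causal_compl O2 ->
    forall T1 T2, A O1 T1 -> A O2 T2 -> T1 \o T2 = T2 \o T1;
  net_translations : translation_rep U;
  net_covariance : forall O x, double_cone O ->
    [set U x \o T \o adj (U x) | T in A O] = A (translate O x);
  net_spectrum : exists2 P, spectral_measure_of U P &
    spectral_support P `<=` closed_forward_cone;
  net_vacuum : `|Omega| = 1 /\ forall x, U x Omega = Omega;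
  net_vacuum_unique : forall u, `|u| = 1 -> (forall x, U x u = u) ->
    exists2 c : R[i], `|c| = 1 & u = c *: Omega;
  net_irreducible : irreducible (quasilocal A);
  haag_duality_double_cone : forall O, double_cone O ->
    commutant (alg A (causal_compl O)) = commutant (commutant (A O));
  haag_duality_spacelike_cone : forall C, spacelike_cone C ->
    commutant (alg A (causal_compl C)) = commutant (commutant (alg A C)) }.

(** * Superselection sectors *)

Implicit Types (eta rho : op -> op) (T V : op).

Definition Hom A eta1 eta2 : set op :=
  [set T | bounded_op T /\
           forall X, quasilocal A X -> T \o eta1 X = eta2 X \o T].

Definition localised A S eta : Prop :=
  forall X, alg A (causal_compl S) X -> eta X = X.

Definition BF_representation A eta : Prop :=
  representation (quasilocal A) eta /\
  forall C, spacelike_cone C ->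
    unitarily_equivalent (alg A (causal_compl C)) eta id.

Definition cone_vN A Sa (x : Mink R) : set op :=
  commutant (commutant (alg A (causal_compl (translate Sa x)))).

Definition aux_alg A Sa : set op := norm_closure (\bigcup_x cone_vN A Sa x).

(* [E] is the extension of [eta] to the auxiliary algebra.  It is unique as a
   function on [aux_alg A Sa]; its values elsewhere are irrelevant. *)
Definition extension A Sa eta (E : op -> op) : Prop :=
  [/\ representation (aux_alg A Sa) E,
      forall X, quasilocal A X -> E X = eta X
    & forall x, weakly_continuous_on (cone_vN A Sa x) E].

(* Tensor products, with [E1] the extension of the source [eta1] of the first
   factor. *)
Definition tensor_obj (E1 : op -> op) eta2 : op -> op := E1 \o eta2.
Definition tensor_mor T1 (E1 : op -> op) T2 : op := T1 \o E1 T2.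

(* Finite statistical dimension is expressed by the existence of a conjugate:
   (rb^* (x) 1) o (1 (x) r) = 1 and (r^* (x) 1) o (1 (x) rb) = 1. *)
Definition BF_has_conjugate A Sa C eta : Prop :=
  exists etab E Eb r rb,
    [/\ BF_representation A etab /\ localised A C etab,
        extension A Sa eta E /\ extension A Sa etab Eb,
        Hom A id (tensor_obj Eb eta) r /\ Hom A id (tensor_obj E etab) rb,
        tensor_mor (adj rb) id id \o tensor_mor id E r = id
      & tensor_mor (adj r) id id \o tensor_mor id Eb rb = id].

Definition Delta_BF A Sa C eta : Prop :=
  [/\ BF_representation A eta, localised A C eta & BF_has_conjugate A Sa C eta].

Definition endomorphism A rho : Prop :=
  representation (quasilocal A) rho /\
  forall X, quasilocal A X -> quasilocal A (rho X).

Definition DHR_endomorphism A O rho : Prop :=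
  [/\ endomorphism A rho, localised A O rho
    & forall Oh, double_cone Oh -> exists rhoh,
        [/\ endomorphism A rhoh, localised A Oh rhoh
          & unitarily_equivalent (quasilocal A) rho rhoh]].

Definition DHR_has_conjugate A O rho : Prop :=
  exists rhob r rb,
    [/\ DHR_endomorphism A O rhob,
        Hom A id (tensor_obj rhob rho) r /\ quasilocal A r,
        Hom A id (tensor_obj rho rhob) rb /\ quasilocal A rb,
        tensor_mor (adj rb) id id \o tensor_mor id rho r = id
      & tensor_mor (adj r) id id \o tensor_mor id rhob rb = id].

Definition Delta_DHR A O rho : Prop :=
  DHR_endomorphism A O rho /\ DHR_has_conjugate A O rho.

(* [eps] is the braiding of eta1 and eta2, as computed from some admissible
   choice of cones C1, C2, of representations etah1, etah2 localised there and
   of unitary intertwiners V1, V2. *)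
Definition is_braiding A Sa eta1 eta2 (eps : op) : Prop :=
  exists E1 E2 C1 C2 (x : Mink R) etah1 etah2 V1 V2,
    [/\ extension A Sa eta1 E1 /\ extension A Sa eta2 E2,
        [/\ spacelike_cone C1, spacelike_cone C2, cone_lt Sa C2 C1
          & C1 `|` C2 `<=` causal_compl (translate Sa x)],
        [/\ BF_representation A etah1, localised A C1 etah1,
            Hom A eta1 etah1 V1, unitary_op V1 & aux_alg A Sa V1],
        [/\ BF_representation A etah2, localised A C2 etah2,
            Hom A eta2 etah2 V2, unitary_op V2 & aux_alg A Sa V2]
      & eps = adj (tensor_mor V2 E2 V1) \o tensor_mor V1 E1 V2].

End Net.

(* Main.v *)
Require Import Defs.
From HB Require Import structures.
From mathcomp Require Import all_boot all_order all_algebra.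
From mathcomp Require Import sesquilinear complex.
From mathcomp Require Import all_classical all_reals all_analysis.
From mathcomp Require Import ring lra.
Set Implicit Arguments.
Unset Strict Implicit.
Unset Printing Implicit Defensive.
Import Order.TTheory GRing.Theory Num.Theory.
Import numFieldNormedType.Exports.
Local Open Scope classical_set_scope.
Local Open Scope ring_scope.

(* Because [rho] is a DHR sector, it can be transported into an arbitrary double
   cone [D] by a unitary [V] that lies in a local algebra.  For every admissible
   choice of cones, the braiding of [eta] and [rho] can be computed from such a
   [V] alone, as [V^* eta(V)] with [D] deep inside the auxiliary cone; the
   braiding of [rho] and [eta] is the adjoint of the same operator.  The choice
   of [D] in the causal complement of the localisation cone [C1] of the
   transported [eta] is immaterial, since any two double cones in that complement
   are joined by a chain of overlapping double cones: if [C1 = c + K] with [K] a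
   convex cone and [y] is spacelike to [C1], then so is [y - K].

   The extensions to the auxiliary algebra are only weakly continuous, so
   intertwining relations on [alg A S] are carried to its bicommutant by the von
   Neumann density theorem. *)

(** * Minkowski geometry *)

Section Geometry.
Context {R : realType}.
Implicit Types (x y p a b c : Mink R) (C D S : set (Mink R)).

(** * Forward cones and double cones *)

Definition dcone a b : set (Mink R) :=
  [set y | forward_cone (y - a) /\ forward_cone (b - y)].

Lemma Mink_eq x y :
  x.1.1 = y.1.1 -> x.1.2 = y.1.2 -> x.2 = y.2 -> x = y.
Proof. by case: x y => [[? ?] ?] [[? ?] ?] /= -> -> ->. Qed.

Lemma forward_coneE x :
  forward_cone x <-> 0 < x.1.1 /\ x.1.2 ^+ 2 + x.2 ^+ 2 < x.1.1 ^+ 2.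
Proof.
rewrite /forward_cone /mink /= !expr2; split=> -[? h]; split=> //; lra.
Qed.

(** By Cauchy-Schwarz the spatial product of [x] and [y] is below the product of their times, so the
    cross term of the Minkowski square is positive. *)
Lemma forward_coneD x y :
  forward_cone x -> forward_cone y -> forward_cone (x + y).
Proof.
case: x y => [[x0 x1] x2] [[y0 y1] y2]; rewrite !forward_coneE /=.
move=> -[x0_gt0 hx] [y0_gt0 hy].
have cs : (x1 * y1 + x2 * y2) ^+ 2 <=
          (x1 ^+ 2 + x2 ^+ 2) * (y1 ^+ 2 + y2 ^+ 2).
  rewrite -subr_ge0 (_ : _ - _ = (x1 * y2 - x2 * y1) ^+ 2) ?sqr_ge0 //.
  by ring.
have : x1 * y1 + x2 * y2 < x0 * y0.
  apply: (le_lt_trans (ler_norm _)).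
  rewrite -(@ltr_pXn2r _ 2%N) ?nnegrE ?mulr_ge0 ?normr_ge0 ?ltW // real_normK ?num_real //.
  apply: (le_lt_trans cs); rewrite exprMn.
  by apply: ltr_pM => //; apply: addr_ge0; apply: sqr_ge0.
move=> h; split; first exact: addr_gt0.
rewrite -subr_gt0.
have -> : (x0 + y0) ^+ 2 - ((x1 + y1) ^+ 2 + (x2 + y2) ^+ 2) =
  (x0 ^+ 2 - (x1 ^+ 2 + x2 ^+ 2)) + (y0 ^+ 2 - (y1 ^+ 2 + y2 ^+ 2)) +
  2 * (x0 * y0 - (x1 * y1 + x2 * y2)) by ring.
by apply: addr_gt0; rewrite ?mulr_gt0 ?subr_gt0 //; apply: addr_gt0; rewrite subr_gt0.
Qed.

Lemma forward_coneZ (t : R) x :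
  0 < t -> forward_cone x -> forward_cone (t *: x).
Proof.
case: x => [[x0 x1] x2] t0; rewrite !forward_coneE /= => -[? h].
split; first exact: mulr_gt0.
by rewrite /GRing.scale /= !exprMn -mulrDr ltr_pM2l // exprn_gt0.
Qed.

(** The Minkowski square of [t *: v + w] is a quadratic in [t] with leading coefficient
    [mink v v > 0]. Every choice of a large enough shift below rests on this. *)
Lemma forward_cone_absorb v w : forward_cone v ->
  exists2 N : R, 0 < N & forall t, N <= t -> forward_cone (t *: v + w).
Proof.
move=> -[v0 qv].
set q := mink v v in qv.
have h1 : 0 <= `|w.1.1| / v.1.1 by rewrite divr_ge0 // ltW.
have h2 : 0 <= (2 * `|mink v w| + `|mink w w|) / q.
  by apply: divr_ge0; [apply: addr_ge0; rewrite ?mulr_ge0|exact: ltW].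
exists (1 + `|w.1.1| / v.1.1 + (2 * `|mink v w| + `|mink w w|) / q); first by lra.
move=> t ht.
have t1 : 1 <= t by lra.
split.
  have : 1 + `|w.1.1| / v.1.1 <= t by lra.
  rewrite -(ler_pM2r v0) mulrDl divfK ?gt_eqF // mul1r.
  rewrite /= /GRing.scale /= => h; have := ler_norm (- w.1.1); rewrite normrN; lra.
have h3 : q + (2 * `|mink v w| + `|mink w w|) <= t * q.
  have : 1 + (2 * `|mink v w| + `|mink w w|) / q <= t by lra.
  by rewrite -(ler_pM2r qv) mulrDl divfK ?gt_eqF // mul1r.
have -> : mink (t *: v + w) (t *: v + w) = t * (t * q + 2 * mink v w) + mink w w.
  rewrite /q /mink /= /GRing.scale /=; ring.
have := ler_norm (- mink v w); have := ler_norm (- mink w w); rewrite !normrN.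
move=> h4 h5.
have h6 : `|mink w w| + q <= t * q + 2 * mink v w by lra.
have h7 : t * q + 2 * mink v w <= t * (t * q + 2 * mink v w).
  by rewrite ler_peMl //; apply: le_trans h6; rewrite addr_ge0 // ltW.
lra.
Qed.

Lemma forward_cone_sub_trans x y a :
  forward_cone (x - a) -> forward_cone (y - x) -> forward_cone (y - a).
Proof. by move=> h1 h2; rewrite -(subrK x y) -addrA; exact: forward_coneD. Qed.

Lemma dcone_double a b : forward_cone (b - a) -> double_cone (dcone a b).
Proof. by move=> h; exists a, b. Qed.

Lemma sub_dcone a b a' b' :
  (a' = a \/ forward_cone (a - a')) -> (b' = b \/ forward_cone (b' - b)) ->
  dcone a b `<=` dcone a' b'.
Proof.
move=> ha hb y [h1 h2]; split.
  by case: ha => [->//|h]; exact: forward_cone_sub_trans h h1.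
by case: hb => [->//|h]; exact: forward_cone_sub_trans h2 h.
Qed.

Lemma forward_cone_half x : forward_cone x -> forward_cone (2^-1 *: x).
Proof. by apply: forward_coneZ; rewrite invr_gt0. Qed.

Lemma double_cone_neq0 D : double_cone D -> D !=set0.
Proof.
move=> [a [b [h ->]]]; exists (2^-1 *: (a + b)).
have K (u : Mink R) : (2^-1 : R) *: (u + u) = u :> Mink R.
  by rewrite scalerDr -scalerDl (_ : 2^-1 + 2^-1 = 1 :> R) ?scale1r; last lra.
have E1 : 2^-1 *: (a + b) - a = 2^-1 *: (b - a).
  by rewrite -[X in _ - X]K -scalerBr opprD addrACA subrr add0r.
have E2 : b - 2^-1 *: (a + b) = 2^-1 *: (b - a).
  by rewrite -[X in X - _]K -scalerBr opprD addrACA subrr addr0.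
by split; rewrite ?E1 ?E2; exact: forward_cone_half.
Qed.

Lemma dcone_convex a b (l m : R) p q : 0 < l -> 0 < m ->
  dcone a b p -> dcone a b q ->
  exists2 r, dcone a b r & l *: p + m *: q = (l + m) *: r.
Proof.
move=> l0 m0 [pa pb] [qa qb].
have lm0 : 0 < l + m by exact: addr_gt0.
have lmN : l + m != 0 by rewrite gt_eqF.
exists ((l + m)^-1 *: (l *: p + m *: q)); last first.
  by rewrite scalerA divff // scale1r.
have K u : (l + m)^-1 *: (l *: u + m *: u) = u.
  by rewrite -scalerDl scalerA mulVf // scale1r.
split.
  rewrite -[X in _ - X]K -scalerBr opprD addrACA -!scalerBr.
  by apply: forward_coneZ; rewrite ?invr_gt0 //; apply: forward_coneD; exact: forward_coneZ.
rewrite -[X in X - _]K -scalerBr opprD addrACA -!scalerBr.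
by apply: forward_coneZ; rewrite ?invr_gt0 //; apply: forward_coneD; exact: forward_coneZ.
Qed.

(** * Causal complements and translations *)

Lemma causal_complS S S' : S `<=` S' -> causal_compl S' `<=` causal_compl S.
Proof. by move=> h y hy x /h; exact: hy. Qed.

Lemma minkN x : mink (- x) (- x) = mink x x.
Proof. by rewrite /mink /=; ring. Qed.

Lemma sub_causal_complC S S' : S `<=` causal_compl S' -> S' `<=` causal_compl S.
Proof. by move=> h y hy x hx; rewrite -minkN opprB; exact: h. Qed.

Lemma causal_compl_translate S x :
  causal_compl (translate S x) = translate (causal_compl S) x.
Proof.
apply/seteqP; split=> [y hy|_ [y hy <-] _ [z hz <-]].
  exists (y - x); last by rewrite subrK.
  move=> z hz; rewrite -addrA -opprD [x + z]addrC; apply: hy; by exists z.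
by rewrite opprD addrACA subrr addr0; exact: hy.
Qed.

Lemma translate_dcone a b x : translate (dcone a b) x = dcone (a + x) (b + x).
Proof.
apply/seteqP; split=> [_ [y [h1 h2] <-]|y [h1 h2]].
  by split; rewrite opprD addrACA subrr addr0.
exists (y - x); last by rewrite subrK.
split; first by rewrite addrAC -addrA -opprD.
by rewrite opprB addrA.
Qed.

Lemma spacelike_cone_translate C x :
  spacelike_cone C -> spacelike_cone (translate C x).
Proof.
move=> [c [D [dD D0 CE CC]]]; exists (c + x), D; split=> //; last first.
  by rewrite !causal_compl_translate CC.
rewrite CE; apply/seteqP; split=> [_ [_ [l l0 [y hy <-]] <-]|_ [l l0 [y hy <-]]].
  by exists l => //; exists y => //; rewrite addrAC.
by exists (c + l *: y); [exists l => //; exists y | rewrite addrAC].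
Qed.

(** * Cones over a double cone, and shifts along a direction [q] of the cone *)

Definition cone_over c a b : set (Mink R) :=
  [set c + l *: y | l in [set l : R | 0 < l] & y in dcone a b].

Lemma spacelike_coneE C : spacelike_cone C ->
  exists c a b q, dcone a b q /\ C = cone_over c a b.
Proof.
move=> [c [D [dD _ CE _]]]; have [q Dq] := double_cone_neq0 dD.
move: dD => [a [b [ab DE]]].
by exists c, a, b, q; rewrite CE DE; rewrite DE in Dq.
Qed.

Lemma cone_over_add c a b p q (l m : R) : 0 < l -> 0 < m ->
  dcone a b p -> dcone a b q -> cone_over c a b (c + (l *: p + m *: q)).
Proof.
move=> l0 m0 hp hq; have [r hr ->] := dcone_convex l0 m0 hp hq.
by exists (l + m); [exact: addr_gt0 | exists r].
Qed.

(** Moving [y] by [- (t *: q)] amounts to moving the points of the cone by [t *: q], which keeps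
    them in the cone. *)
Lemma causal_compl_cone_shift c a b q (t : R) y : dcone a b q -> 0 < t ->
  causal_compl (cone_over c a b) y -> causal_compl (cone_over c a b) (y - t *: q).
Proof.
move=> hq t0 hy _ [l l0 [p hp <-]].
rewrite -addrA -opprD addrCA [t *: q + _]addrC.
by apply: hy; exact: cone_over_add.
Qed.

(** The right-hand double cone is [y] minus the [t]-fold dilate of [dcone a b]. Seen from
    [- (t *: q)] its tips recede along the timelike vectors [b - q] and [q - a], so it eventually
    swallows the translate of [D]. *)
Lemma translate_double_cone_absorbed a b q y D : dcone a b q -> double_cone D ->
  exists2 N : R, 0 < N & forall t, N <= t ->
    translate D (- (t *: q)) `<=` dcone (y - t *: b) (y - t *: a).
Proof.
move=> [aq qb] [a' [b' [ab' ->]]].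
have [N1 N10 h1] := forward_cone_absorb (a' - y) qb.
have [N2 _ h2] := forward_cone_absorb (y - b') aq.
exists (Num.max N1 N2); first by rewrite lt_max N10.
move=> t; rewrite ge_max => /andP[t1 t2].
rewrite translate_dcone; apply: sub_dcone; right.
  rewrite (_ : _ - _ = t *: (b - q) + (a' - y)); first exact: h1.
  by apply: Mink_eq; rewrite /= /GRing.scale /=; ring.
rewrite (_ : _ - _ = t *: (q - a) + (y - b')); first exact: h2.
by apply: Mink_eq; rewrite /= /GRing.scale /=; ring.
Qed.

Lemma shift_sub_causal_compl c a b q y (t : R) : dcone a b q -> 0 < t ->
  causal_compl (cone_over c a b) y ->
  dcone (y - t *: b) (y - t *: a) `<=` causal_compl (cone_over c a b).
Proof.
move=> hq t0 hy z [z1 z2].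
(* The rescaled difference [t^-1 *: (y - z)] lies in [dcone a b], hence is an admissible direction
   for the shift. *)
have -> : z = y - t *: (t^-1 *: (y - z)).
  by rewrite scalerA divff ?gt_eqF // scale1r opprB addrC subrK.
apply: causal_compl_cone_shift => //.
have K u : t^-1 *: (t *: u) = u by rewrite scalerA mulVf ?gt_eqF // scale1r.
split.
  rewrite -[X in _ - X]K -scalerBr; apply: forward_coneZ; rewrite ?invr_gt0 //.
  by rewrite addrAC.
rewrite -[X in X - _]K -scalerBr; apply: forward_coneZ; rewrite ?invr_gt0 //.
by rewrite (_ : _ - _ = z - (y - t *: b)) // !opprB addrCA.
Qed.

Lemma double_cone_translate D x : double_cone D -> double_cone (translate D x).
Proof.
move=> [a [b [ab ->]]]; rewrite translate_dcone; apply: dcone_double.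
by rewrite opprD addrACA subrr addr0.
Qed.

Lemma sub_translateE D S x : translate D (- x) `<=` S <-> D `<=` translate S x.
Proof.
split=> [h y hy|]; first by exists (y - x); [apply: h; exists y|rewrite subrK].
by move=> h _ [y /h [z hz <-] <-]; rewrite addrK.
Qed.

(** The tips of the first double cone are moved far into the past and the future along the time axis
    [T]. *)
Lemma double_cone_bigger D D' : double_cone D -> double_cone D' ->
  exists2 D'', double_cone D'' & D `|` D' `<=` D''.
Proof.
move=> [a [b [ab ->]]] [a' [b' [ab' ->]]].
pose T : Mink R := (1, 0, 0).
have T0 : forward_cone T by rewrite /forward_cone /mink /=; split; lra.
have [N1 N10 h1] := forward_cone_absorb (a' - a) T0.
have [N2 N20 h2] := forward_cone_absorb (b - b') T0.
exists (dcone (a - N1 *: T) (b + N2 *: T)); last first.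
  rewrite subUset; split; apply: sub_dcone; right.
  - by rewrite opprB addrCA subrr addr0; exact: forward_coneZ.
  - by rewrite addrC addKr; exact: forward_coneZ.
  - rewrite (_ : _ - _ = N1 *: T + (a' - a)); first exact: h1.
    by rewrite opprB addrCA.
  - rewrite (_ : _ - _ = N2 *: T + (b - b')); first exact: h2.
    by rewrite addrAC addrC.
apply: dcone_double; rewrite (_ : _ - _ = (b - a) + (N1 *: T + N2 *: T)).
  apply: forward_coneD => //.
  by apply: forward_coneD; exact: forward_coneZ.
by apply: Mink_eq; rewrite /= /GRing.scale /=; ring.
Qed.

Lemma spacelike_cone_double C : spacelike_cone C ->
  exists2 D, double_cone D & D `<=` C.
Proof.
move=> [c [D [dD _ -> _]]]; exists (translate D c); first exact: double_cone_translate.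
by move=> _ [y hy <-]; exists 1; rewrite /= ?ltr01 //; exists y => //; rewrite scale1r addrC.
Qed.

(** Take [y := x + N *: q] with [N] large. Then also [y = x' + N *: r], where [r] differs from [q]
    by [N^-1 *: (x - x')] and so still lies in [dcone a b]. *)
Lemma spacelike_cone_translate_sub C x x' : spacelike_cone C ->
  exists2 y, translate C y `<=` translate C x & translate C y `<=` translate C x'.
Proof.
move=> /spacelike_coneE [c [a [b [q [hq ->]]]]].
have [aq qb] := hq.
have [N1 N10 h1] := forward_cone_absorb (x - x') aq.
have [N2 N20 h2] := forward_cone_absorb (x' - x) qb.
have t0 : 0 < N1 + N2 by exact: addr_gt0.
exists (x + (N1 + N2) *: q).
  move=> _ [_ [l l0 [p hp <-]] <-].
  exists (c + (l *: p + (N1 + N2) *: q)); first exact: cone_over_add.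
  by rewrite -!addrA; congr (_ + _); congr (_ + _); rewrite addrC.
have hr : dcone a b ((N1 + N2)^-1 *: ((N1 + N2) *: q + (x - x'))).
  have K u : (N1 + N2)^-1 *: ((N1 + N2) *: u) = u.
    by rewrite scalerA mulVf ?gt_eqF // scale1r.
  split.
    rewrite -[X in _ - X]K -scalerBr; apply: forward_coneZ; rewrite ?invr_gt0 //.
    by rewrite addrAC -scalerBr; apply: h1; rewrite lerDl ltW.
  rewrite -[X in X - _]K -scalerBr; apply: forward_coneZ; rewrite ?invr_gt0 //.
  by rewrite opprD addrA -scalerBr opprB; apply: h2; rewrite lerDr ltW.
move=> _ [_ [l l0 [p hp <-]] <-].
exists (c + (l *: p + (N1 + N2) *: ((N1 + N2)^-1 *: ((N1 + N2) *: q + (x - x'))))).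
  exact: cone_over_add.
rewrite scalerA divff ?gt_eqF // scale1r.
by apply: Mink_eq; rewrite /= /GRing.scale /=; ring.
Qed.

(** Shifting [D] far along [- q] brings it into the reflected cone at a point [y] of [S], which is
    spacelike to [C]; equivalently [C] is shifted along [q]. *)
Lemma double_cone_in_translate_compl C S D : spacelike_cone C ->
  S !=set0 -> S `<=` causal_compl C -> double_cone D ->
  exists x, D `<=` causal_compl (translate C x).
Proof.
move=> /spacelike_coneE [c [a [b [q [hq ->]]]]] [y Sy] SC dD.
have [N N0 hN] := translate_double_cone_absorbed y hq dD.
exists (N *: q); rewrite causal_compl_translate -sub_translateE.
apply: (subset_trans (hN N (lexx _))).
exact: shift_sub_causal_compl hq N0 (SC _ Sy).
Qed.

Lemma causal_compl_connected C (P : set (Mink R) -> Prop) : spacelike_cone C ->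
  (forall D D', double_cone D -> double_cone D' -> D `<=` D' ->
     D' `<=` causal_compl C -> P D <-> P D') ->
  forall D D', double_cone D -> double_cone D' ->
    D `<=` causal_compl C -> D' `<=` causal_compl C -> P D -> P D'.
Proof.
move=> /spacelike_coneE [c [a [b [q [hq ->]]]]] Pmono.
set C' := causal_compl _ in Pmono *.
have shiftC (D : set (Mink R)) t : 0 <= t -> D `<=` C' -> translate D (- (t *: q)) `<=` C'.
  rewrite le_eqVlt => /predU1P[<-|t0] DC _ [y /DC hy <-].
    by rewrite scale0r oppr0 addr0.
  exact: causal_compl_cone_shift.
(* Two translates of [D] by nearby points contain a common double cone. *)
have step D : double_cone D -> exists2 d : R, 0 < d & forall s (t : R),
    D `<=` C' -> 0 <= s -> s <= t -> t <= s + d ->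
    P (translate D (- (s *: q))) <-> P (translate D (- (t *: q))).
  move=> [a1 [b1 [ab1 ->]]].
  (* With a third of the diagonal cut off at both tips, a double cone of diagonal [w] remains. The
     margin [w] at each tip absorbs the displacement [(t - s) *: q] as long as [t - s <= N^-1]. *)
  have w0 : forward_cone (3^-1 *: (b1 - a1)) by apply: forward_coneZ; rewrite ?invr_gt0.
  set w := 3^-1 *: _ in w0.
  have [N1 N10 h1] := forward_cone_absorb q w0.
  have [N2 N20 h2] := forward_cone_absorb (- q) w0.
  pose N := N1 + N2.
  have N0 : 0 < N by exact: addr_gt0.
  exists N^-1; first by rewrite invr_gt0.
  move=> s t DC s0 st td.
  have hd e : 0 <= e -> e <= N^-1 -> forward_cone (w + e *: q) /\ forward_cone (w - e *: q).
    rewrite le_eqVlt => /predU1P[<- _|e0 eN]; first by rewrite scale0r oppr0 addr0.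
    have eN' : N <= e^-1 by rewrite -[leLHS]invrK lef_pV2 ?posrE ?invr_gt0.
    have K u : e *: (e^-1 *: u) = u by rewrite scalerA divff ?gt_eqF // scale1r.
    split.
      rewrite -[w]K -scalerDr; apply: forward_coneZ => //; apply: h1.
      by apply: le_trans eN'; rewrite lerDl ltW.
    rewrite -[w]K -scalerBr; apply: forward_coneZ => //; apply: h2.
    by apply: le_trans eN'; rewrite lerDr ltW.
  have [] := hd (t - s); [by rewrite subr_ge0|by rewrite lerBlDl|].
  move=> wp wm.
  have E : b1 - a1 = w + w + w.
    by apply: Mink_eq; rewrite /w /= /GRing.scale /=; field.
  pose D' := dcone (a1 - s *: q + w) (b1 - s *: q - w).
  have dD' : double_cone D'.
    apply: dcone_double; rewrite (_ : _ - _ = w) //.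
    rewrite (_ : _ - _ = (b1 - a1) - w - w); first by rewrite E addrK addrK.
    by apply: Mink_eq; rewrite /w /= /GRing.scale /=; ring.
  have dDs u : double_cone (translate (dcone a1 b1) u).
    by apply: double_cone_translate; exact: dcone_double.
  have t0 : 0 <= t by exact: le_trans st.
  transitivity (P D').
    symmetry; apply: Pmono => //; last exact: shiftC.
    rewrite translate_dcone; apply: sub_dcone; right.
      by rewrite addrC addKr.
    by rewrite opprB addrCA subrr addr0.
  apply: Pmono => //; last exact: shiftC.
  rewrite translate_dcone; apply: sub_dcone; right.
    rewrite (_ : _ - _ = w + (t - s) *: q) //.
    by apply: Mink_eq; rewrite /w /= /GRing.scale /=; ring.
  rewrite (_ : _ - _ = w - (t - s) *: q) //.
  by apply: Mink_eq; rewrite /w /= /GRing.scale /=; ring.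
have slide D t : double_cone D -> D `<=` C' -> 0 <= t ->
    P D <-> P (translate D (- (t *: q))).
  move=> dD DC t0; have [d d0 hd] := step D dD.
  have chain n : P D <-> P (translate D (- ((d *+ n) *: q))).
    elim: n => [|n ->].
      rewrite mulr0n scale0r oppr0 (_ : translate D 0 = D) //.
      apply/seteqP; split=> [_ [y hy <-]|y hy]; first by rewrite addr0.
      by exists y => //; rewrite addr0.
    apply: hd => //; first by rewrite mulrn_wge0 // ltW.
      by rewrite mulrSr lerDl ltW.
    by rewrite mulrSr.
  (* After [n] full steps of length [d], a last step shorter than [d] reaches [t]. *)
  pose n := Num.trunc (t / d).
  have /andP[n1 n2] := truncn_itv (divr_ge0 t0 (ltW d0)).
  rewrite (chain n); apply: hd => //; first by rewrite mulrn_wge0 // ltW.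
    by rewrite -mulr_natl -ler_pdivlMr.
  by rewrite -mulrSr -mulr_natl -ler_pdivrMr // ltW.
move=> D D' dD dD' DC D'C.
(* Both double cones slide along [- q] until they lie in one large double cone, part of the
   reflected cone at a point [y] of [D]. *)
have [y Dy] := double_cone_neq0 dD.
have [N N0 hN] := translate_double_cone_absorbed y hq dD.
have [N' N0' hN'] := translate_double_cone_absorbed y hq dD'.
pose t := N + N'.
have t0 : 0 < t by exact: addr_gt0.
have yC : dcone (y - t *: b) (y - t *: a) `<=` C'.
  exact: shift_sub_causal_compl hq t0 (DC _ Dy).
have dy : double_cone (dcone (y - t *: b) (y - t *: a)).
  apply: dcone_double; rewrite (_ : _ - _ = t *: (b - a)).
    by apply: forward_coneZ => //; case: hq => h1 h2; exact: forward_cone_sub_trans h1 h2.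
  by apply: Mink_eq; rewrite /= /GRing.scale /=; ring.
rewrite (slide D t) ?(slide D' t) //; try exact: ltW.
rewrite (Pmono _ _ (double_cone_translate _ dD) dy) //; last first.
  by apply: hN; rewrite lerDl ltW.
rewrite (Pmono _ _ (double_cone_translate _ dD') dy) //.
by apply: hN'; rewrite lerDr ltW.
Qed.

End Geometry.

(** * Semi-inner products *)

Section SemiInner.
Context {R : realType}.
Local Notation Re := complex.Re.
Local Notation Im := complex.Im.
Local Notation "x %:C" := (real_complex _ x) : ring_scope.

Lemma complex_ReD (x y : R[i]) : Re (x + y) = Re x + Re y. Proof. by case: x y => [? ?] []. Qed.
Lemma complex_ReN (x : R[i]) : Re (- x) = - Re x. Proof. by case: x. Qed.
Lemma complex_ReM (x y : R[i]) : Re (x * y) = Re x * Re y - Im x * Im y.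
Proof. by case: x y => [? ?] []. Qed.
Lemma complex_ReJ (x : R[i]) : Re (Num.conj x) = Re x. Proof. by case: x. Qed.
Lemma complex_ImJ (x : R[i]) : Im (Num.conj x) = - Im x. Proof. by case: x. Qed.
Lemma complex_eq (x y : R[i]) : Re x = Re y -> Im x = Im y -> x = y.
Proof. by case: x y => [? ?] [? ?] /= -> ->. Qed.

(** Abstract so as to serve both [H] and its finite powers in the density theorem. *)
Record semi_inner (V : lmodType R[i]) (ip : V -> V -> R[i]) : Prop := {
  ip_linear : forall w, scalar (ip ^~ w);
  ip_herm : forall u v, ip v u = Num.conj (ip u v);
  ip_ge0 : forall u, 0 <= ip u u }.

Section Theory.
Context {V : lmodType R[i]} {ip : V -> V -> R[i]} (ipP : semi_inner ip).
Implicit Types (u v w : V) (K : set V).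

(** Taken in [R] rather than in [R[i]], so that estimates are real arithmetic. *)
Definition sqn u : R := Re (ip u u).

Lemma ipDl u v w : ip (u + v) w = ip u w + ip v w.
Proof. by have := ip_linear ipP w 1 u v; rewrite scale1r mul1r. Qed.

Lemma ip0l w : ip 0 w = 0.
Proof. by apply: (addIr (ip 0 w)); rewrite add0r -ipDl addr0. Qed.

Lemma ipZl a u w : ip (a *: u) w = a * ip u w.
Proof. by have := ip_linear ipP w a u 0; rewrite ip0l !addr0. Qed.

Lemma ipNl u w : ip (- u) w = - ip u w.
Proof. by rewrite -scaleN1r ipZl mulN1r. Qed.

Lemma ipDr u v w : ip w (u + v) = ip w u + ip w v.
Proof. by rewrite (ip_herm ipP) ipDl rmorphD /= -!(ip_herm ipP). Qed.

Lemma ipNr u w : ip w (- u) = - ip w u.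
Proof. by rewrite (ip_herm ipP) ipNl rmorphN /= -(ip_herm ipP). Qed.

Lemma ipBr u v w : ip w (u - v) = ip w u - ip w v.
Proof. by rewrite ipDr ipNr. Qed.

Lemma ipBl u v w : ip (u - v) w = ip u w - ip v w.
Proof. by rewrite ipDl ipNl. Qed.

Lemma ipZr a u w : ip w (a *: u) = Num.conj a * ip w u.
Proof. by rewrite (ip_herm ipP) ipZl rmorphM /= -(ip_herm ipP). Qed.

Lemma ipRe u v : Re (ip u v) = Re (ip v u).
Proof. by rewrite (ip_herm ipP) complex_ReJ. Qed.

Lemma sqn_ge0 u : 0 <= sqn u.
Proof. by have := ip_ge0 ipP u; rewrite lecE => /andP[]. Qed.

Lemma sqnE u : ip u u = (sqn u)%:C.
Proof. by have /RRe_real <- := ger0_real (ip_ge0 ipP u). Qed.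

Lemma sqnD u v : sqn (u + v) = sqn u + 2 * Re (ip u v) + sqn v.
Proof. by rewrite /sqn ipDl !ipDr !complex_ReD (ipRe v u); ring. Qed.

Lemma sqnZ (t : R) u : sqn (t%:C *: u) = t ^+ 2 * sqn u.
Proof. by rewrite /sqn ipZl ipZr !complex_ReM /= oppr0; ring. Qed.

Lemma sqnN u : sqn (- u) = sqn u.
Proof. by rewrite /sqn ipNl ipNr opprK. Qed.

(** Cauchy-Schwarz, from the nonnegative quadratic [t |-> sqn (u + t v)]. *)
Lemma Re_ip_sqr u v : Re (ip u v) ^+ 2 <= sqn u * sqn v.
Proof.
have h t : 0 <= sqn u + 2 * t * Re (ip u v) + t ^+ 2 * sqn v.
  have := sqn_ge0 (u + t%:C *: v).
  by rewrite sqnD sqnZ ipZr !complex_ReM /= oppr0; congr (0 <= _); ring.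
have := sqn_ge0 v; rewrite le_eqVlt => /predU1P[v0|v0].
  rewrite -v0 mulr0; rewrite -v0 in h.
  have [->|b0] := eqVneq (Re (ip u v)) 0; first by rewrite expr0n.
  (* When [sqn v = 0] the quadratic is affine in [t], and at this [t] it would equal [-1]. *)
  have := h (- (sqn u + 1) / (2 * Re (ip u v))); rewrite mulr0 addr0.
  rewrite (_ : 2 * _ * _ = - (sqn u + 1)); first by lra.
  by field.
have := h (- Re (ip u v) / sqn v).
rewrite (_ : _ + _ = (sqn u * sqn v - Re (ip u v) ^+ 2) / sqn v); last first.
  by field; rewrite gt_eqF.
by rewrite pmulr_lge0 ?invr_gt0 // subr_ge0.
Qed.

Lemma sqnD_le u v : sqn (u + v) <= 2 * (sqn u + sqn v).
Proof. by have := sqn_ge0 (u - v); rewrite !sqnD sqnN ipNr complex_ReN; lra. Qed.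

Definition seq_complete K := forall x : nat -> V, (forall n, K (x n)) ->
  (forall e : R, 0 < e -> exists N, forall n m, (N <= n)%N -> (N <= m)%N ->
     sqn (x n - x m) < e) ->
  exists2 l, K l & forall e : R, 0 < e -> exists N, forall n, (N <= n)%N ->
     sqn (x n - l) < e.

Definition lin_subspace K := K 0 /\ forall a u v, K u -> K v -> K (a *: u + v).

Lemma lin_subspaceD K u v : lin_subspace K -> K u -> K v -> K (u + v).
Proof. by move=> [_ h] Ku Kv; rewrite -[u]scale1r; exact: h. Qed.

Lemma lin_subspaceZ K a u : lin_subspace K -> K u -> K (a *: u).
Proof. by move=> [h0 h] Ku; rewrite -[_ *: _]addr0; exact: h. Qed.

(* The Riesz vector is the limit of a minimising sequence of
   [|u|^2 - 2 Re (f u)], Cauchy by the parallelogram identity. *)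
Lemma riesz_on_subspace K (f : V -> R[i]) (c : R) : 0 <= c -> lin_subspace K -> seq_complete K ->
  (forall a u v, K u -> K v -> f (a *: u + v) = a * f u + f v) ->
  (forall u, K u -> Re (f u) ^+ 2 <= c * sqn u) ->
  exists2 u, K u & forall w, K w -> f w = ip w u.
Proof.
move=> c0 Ksub Kcompl flin fbound.
have K0 := Ksub.1.
have fD u v : K u -> K v -> f (u + v) = f u + f v.
  by move=> Ku Kv; rewrite -[u in LHS]scale1r flin // mul1r.
have f0 : f 0 = 0 by apply: (addIr (f 0)); rewrite add0r -fD // addr0.
have fZ a u : K u -> f (a *: u) = a * f u.
  by move=> Ku; rewrite -[_ *: _]addr0 flin // f0 addr0.
pose J u := sqn u - 2 * Re (f u).
pose E := [set J u | u in K].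
have Elb : has_lbound E.
  exists (- c) => _ [u Ku <-]; rewrite /J.
  have := fbound u Ku; have := sqn_ge0 u; move: (sqn u) (Re (f u)) => q g q0 h.
  rewrite leNgt; apply/negP => lt_q; have := sqr_ge0 (q - c); nra.
have Einf : has_inf E by split=> //; exists (J 0), 0.
pose m := inf E.
have mJ u : K u -> m <= J u by move=> Ku; apply: ge_inf => //; exists u.
pose d n : R := n.+1%:R^-1.
have d0 n : 0 < d n by rewrite invr_gt0.
have xP n : exists u, K u /\ J u < m + d n.
  by have [_ [u Ku <-] ?] := inf_adherent (d0 n) Einf; exists u.
pose x n := projT1 (cid (xP n)).
have Kx n : K (x n) by rewrite /x; case: cid => ? [].
have Jx n : J (x n) < m + d n by rewrite /x; case: cid => ? [].
have dlim (e : R) : 0 < e -> exists N, forall n, (N <= n)%N -> d n < e.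
  move=> e0; exists (Num.truncn e^-1) => n Nn.
  rewrite /d -[e]invrK ltf_pV2 ?posrE ?invr_gt0 //.
  by apply: lt_le_trans (truncnS_gt _) _; rewrite ler_nat.
have cauchy n k : sqn (x n - x k) < 2 * (d n + d k).
  have Kp : K (2^-1%:C *: (x n + x k)) by apply: lin_subspaceZ => //; exact: lin_subspaceD.
  have := mJ _ Kp.
  rewrite /J sqnZ fZ; last exact: lin_subspaceD.
  rewrite fD // complex_ReM /= mul0r subr0 complex_ReD !sqnD sqnN ipNr complex_ReN.
  by have := Jx n; have := Jx k; rewrite /J; lra.
have [|u Ku ulim] := Kcompl x Kx.
  move=> e e0; have [N hN] := dlim (e / 4) (divr_gt0 e0 (ltr0n _ 4)).
  exists N => n k Nn Nk; apply: lt_trans (cauchy n k) _.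
  by have := hN n Nn; have := hN k Nk; lra.
exists u => //.
have key w : K w -> Re (f w) = Re (ip w u).
  (* The added one keeps [b] positive when [w] has seminorm zero. *)
  move=> Kw; pose b := sqn w + 1; have b0 : 0 < b by rewrite ltr_wpDl ?sqn_ge0.
  have hx n : (Re (ip (x n) w) - Re (f w)) ^+ 2 <= b * d n.
    set D := _ - _.
    (* Up to replacing [sqn w] by [b], this [t] minimises [J] on the line through [x n] along [w];
       there [J] can fall by less than [d n], which bounds [D ^+ 2]. *)
    pose t := - D / b.
    have Kt : K (t%:C *: w) by exact: lin_subspaceZ.
    have := mJ _ (lin_subspaceD Ksub (Kx n) Kt); have := Jx n.
    rewrite /J sqnD sqnZ fD // fZ // ipZr !complex_ReD !complex_ReM /= oppr0 !mul0r !subr0.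
    have -> : sqn w = b - 1 by rewrite /b addrK.
    have -> : Re (f w) = Re (ip (x n) w) - D by rewrite /D; ring.
    move=> h1 h2.
    have : - 2 * t * D - t ^+ 2 * (b - 1) < d n by lra.
    have -> : - 2 * t * D - t ^+ 2 * (b - 1) = D ^+ 2 / b + (D / b) ^+ 2.
      by rewrite /t; field; rewrite gt_eqF.
    have := sqr_ge0 (D / b) => h3 h4.
    have : D ^+ 2 / b <= d n by lra.
    by rewrite ler_pdivrMr // mulrC.
  have hu n : Re (ip (x n - u) w) ^+ 2 <= b * sqn (x n - u).
    rewrite mulrC; apply: le_trans (Re_ip_sqr _ _) _.
    by rewrite ler_wpM2l ?sqn_ge0 // /b lerDl.
  apply/eqP; rewrite -subr_eq0 -sqrf_eq0 eq_le sqr_ge0 andbT.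
  apply/ler_addgt0Pr => e e0; rewrite add0r.
  have e4 : 0 < e / (4 * b) by rewrite divr_gt0 // mulr_gt0.
  have [N1 h1] := ulim _ e4; have [N2 h2] := dlim _ e4.
  pose n := maxn N1 N2.
  have {}h1 : b * sqn (x n - u) <= e / 4.
    by have := h1 n (leq_maxl _ _); rewrite -(ltr_pM2l b0) (_ : b * (e / _) = e / 4) => [/ltW //|]; field; rewrite gt_eqF.
  have {}h2 : b * d n <= e / 4.
    by have := h2 n (leq_maxr _ _); rewrite -(ltr_pM2l b0) (_ : b * (e / _) = e / 4) => [/ltW //|]; field; rewrite gt_eqF.
  have := le_trans (hx n) h2; have := le_trans (hu n) h1.
  rewrite ipBl complex_ReD complex_ReN (ipRe w u).
  set p := Re (ip (x n) w); set r := Re (ip u w); set s := Re (f w).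
  have := sqr_ge0 ((p - s) + (p - r)).
  rewrite -subr_ge0 => k1 k2 k3.
  have -> : (s - r) ^+ 2 = 2 * (p - r) ^+ 2 + 2 * (p - s) ^+ 2 - (p - s + (p - r)) ^+ 2.
    by ring.
  by lra.
move=> w Kw; apply: complex_eq; first exact: key.
(* The real parts at ['i *: w] give the imaginary parts at [w]. *)
have := key _ (lin_subspaceZ ('i%C) Ksub Kw); rewrite fZ // ipZl !complex_ReM /=.
by rewrite !mul0r !mul1r !sub0r => /oppr_inj.
Qed.
End Theory.
End SemiInner.

(** * Adjoints *)

Section Adjoint.
Context {R : realType} {H : hilbert R}.
Local Notation Re := complex.Re.
Local Notation Im := complex.Im.
Local Notation "x %:C" := (real_complex _ x) : ring_scope.
Local Notation op := (H -> H).
Local Notation sq := (@sqn R H (hdot H)).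
Implicit Types (A B T : op) (S M : set op) (u v : H).

Lemma hdotP : semi_inner (hdot H).
Proof.
split=> [w a u v|u v|u].
- by rewrite linearPl.
- by rewrite (@hermitian_subproof _ _ _ _ _ v u) expr0 mul1r.
- by rewrite -hnormE exprn_ge0.
Qed.

Lemma hnorm_sqn u : `|u| ^+ 2 = (sq u)%:C.
Proof. by rewrite hnormE (sqnE hdotP). Qed.

Lemma hnorm_ltE u (e : R) : 0 <= e -> (`|u| < e%:C) = (sq u < e ^+ 2).
Proof.
move=> e0; rewrite -ltcR -hnorm_sqn rmorphXn /= ltr_pXn2r // nnegrE //.
by rewrite ler0c.
Qed.

Lemma sqn_eq0 u : sq u = 0 -> u = 0.
Proof.
move=> h; apply/eqP; rewrite -normr_eq0 -sqrf_eq0 hnorm_sqn h.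
by rewrite rmorph0.
Qed.

Lemma real_complexM (x y : R) : (x * y)%:C = x%:C * y%:C.
Proof. exact: rmorphM. Qed.

Lemma ltr0c (x : R) : (0 < x%:C) = (0 < x).
Proof. exact: (ltcR 0). Qed.

Lemma gt0_complexE (e : R[i]) : 0 < e -> exists2 r : R, 0 < r & e = r%:C.
Proof.
move=> e0; have er := RRe_real (gtr0_real e0).
by exists (Re e) => //; rewrite -ltr0c er.
Qed.

Lemma hilbert_complete : seq_complete (ip := hdot H) setT.
Proof.
move=> x _ xc.
have /cauchy_cvg : cauchy (x @ \oo).
  apply: cauchy_exP => _ /gt0_complexE[r r0 ->].
  have [N hN] := xc (r ^+ 2) (exprn_gt0 2 r0).
  exists (x N); exists N => // n /= Nn.
  by rewrite -ball_normE /= hnorm_ltE ?ltW //; apply: hN.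
move=> /cvg_ex[l xl]; exists l => // e e0.
have e'0 : 0 < (Num.sqrt e)%:C by rewrite ltr0c sqrtr_gt0.
have [N _ hN] := cvgr_dist_lt _ _ xl _ e'0.
exists N => n /hN; rewrite hnorm_ltE ?sqrtr_ge0 // sqr_sqrtr ?ltW //.
by rewrite -(sqnN hdotP) opprB.
Qed.

Lemma normc_sqr (c : R[i]) : exists2 r : R, 0 <= r & `|c| ^+ 2 = r%:C.
Proof.
have c0 : 0 <= `|c| ^+ 2 by exact: exprn_ge0.
exists (Re (`|c| ^+ 2)); first by move: c0; rewrite lecE => /andP[].
by rewrite RRe_real // ger0_real.
Qed.

(** The constant of [bounded_op] is complex, but [c * |u|] dominates a norm and hence equals
    [|c| * |u|]; so [k := |c| ^+ 2] works. *)
Lemma bounded_opP A :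
  bounded_op A <-> linear A /\ exists2 k : R, 0 <= k & forall u, sq (A u) <= k * sq u.
Proof.
split=> -[linA].
  move=> [c hc]; split=> //; have [r r0 rE] := normc_sqr c; exists r => // u.
  rewrite -lecR real_complexM -!hnorm_sqn -rE -exprMn.
  rewrite lerXn2r ?nnegrE ?mulr_ge0 //.
  have hu := hc u; have cu : 0 <= c * `|u| by exact: le_trans hu.
  by rewrite -(normr_id u) -normrM (ger0_norm cu).
move=> [k k0 hk]; split=> //; exists (Num.sqrt k)%:C => u.
rewrite -(@ler_pXn2r _ 2%N) ?nnegrE ?mulr_ge0 ?ler0c ?sqrtr_ge0 //.
by rewrite exprMn !hnorm_sqn -rmorphXn /= sqr_sqrtr // -real_complexM lecR.
Qed.

Lemma hdot_eqr v v' : (forall u, '[u, v] = '[u, v']) -> v = v'.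
Proof.
move=> h; apply/eqP; rewrite -subr_eq0; apply/eqP; apply: sqn_eq0.
by rewrite /sqn (ipBr hdotP) h subrr.
Qed.

(** Apply Cauchy-Schwarz to [sq (B v) = Re '[A (B v), v]], then cancel a factor [sq (B v)]. *)
Lemma adjoint_sqn_le A B (k : R) : (forall u v, '[A u, v] = '[u, B v]) ->
  (forall u, sq (A u) <= k * sq u) -> forall v, sq (B v) <= k * sq v.
Proof.
move=> AB hk v.
have : sq (B v) ^+ 2 <= k * sq (B v) * sq v.
  rewrite {1}/sqn -AB; apply: le_trans (Re_ip_sqr hdotP _ _) _.
  by rewrite ler_wpM2r ?(sqn_ge0 hdotP).
have := sqn_ge0 hdotP (B v); rewrite le_eqVlt => /predU1P[<- _|b0].
  exact: le_trans (sqn_ge0 hdotP _) (hk v).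
by rewrite expr2 mulrAC ler_pM2r.
Qed.

Lemma adj_exists A : bounded_op A -> exists B, bounded_op B /\ forall u v, '[A u, v] = '[u, B v].
Proof.
move=> /bounded_opP[linA [k k0 hk]].
have H1 v : exists w, forall u, '[A u, v] = '[u, w].
  have [|||||w _ hw] := @riesz_on_subspace R H (hdot H) hdotP setT
      (fun u => '[A u, v]) (k * sq v).
  - by rewrite mulr_ge0 // (sqn_ge0 hdotP).
  - by [].
  - exact: hilbert_complete.
  - by move=> a u u' _ _; rewrite linA (ip_linear hdotP).
  - move=> u _; apply: le_trans (Re_ip_sqr hdotP _ _) _.
    by rewrite mulrAC ler_wpM2r ?(sqn_ge0 hdotP).
  by exists w => u; exact: hw.
pose B v := projT1 (cid (H1 v)).
have BE u v : '[A u, v] = '[u, B v] by rewrite /B; case: cid.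
exists B; split=> //; apply/bounded_opP; split.
  move=> a u v; apply: hdot_eqr => w.
  by rewrite -BE !(ipDr hdotP) !(ipZr hdotP) !BE.
exists k => // v; exact: adjoint_sqn_le BE hk v.
Qed.

Lemma adjP A : bounded_op A -> bounded_op (adj A) /\ forall u v, '[A u, v] = '[u, adj A v].
Proof. by move=> /adj_exists[B hB]; exact: (@xgetPex _ _ [set B | bounded_op B /\ _] (ex_intro _ B hB)). Qed.

Lemma bounded_adj A : bounded_op A -> bounded_op (adj A).
Proof. by move=> /adjP[]. Qed.

Lemma adjE A u v : bounded_op A -> '[A u, v] = '[u, adj A v].
Proof. by move=> /adjP[]. Qed.

Lemma adj_unique A B : bounded_op A -> (forall u v, '[A u, v] = '[u, B v]) -> adj A = B.
Proof.
move=> bA h; apply/funext => v; apply: hdot_eqr => u.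
by rewrite -adjE // h.
Qed.

Lemma adjK A : bounded_op A -> adj (adj A) = A.
Proof.
move=> bA; apply: adj_unique; first exact: bounded_adj.
by move=> u v; rewrite (ip_herm hdotP) -adjE // -(ip_herm hdotP).
Qed.

Lemma bounded_op_id : bounded_op (id : op).
Proof. by split=> //; exists 1 => u; rewrite mul1r. Qed.

Lemma bounded_op_comp A B : bounded_op A -> bounded_op B -> bounded_op (A \o B).
Proof.
move=> /bounded_opP[lA [k k0 hk]] /bounded_opP[lB [l l0 hl]].
apply/bounded_opP; split; first by move=> a u v /=; rewrite lB lA.
exists (k * l) => [|u]; first exact: mulr_ge0.
by apply: le_trans (hk _) _; rewrite -mulrA ler_wpM2l.
Qed.

Lemma bounded_op_lin a A B : bounded_op A -> bounded_op B -> bounded_op (a *: A + B).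
Proof.
move=> /bounded_opP[lA [k k0 hk]] /bounded_opP[lB [l l0 hl]].
have E u : (a *: A + B) u = a *: A u + B u by [].
apply/bounded_opP; split.
  move=> b u v; rewrite !E lA lB !scalerDr !scalerA [a * b]mulrC.
  by rewrite addrACA.
have [r r0 rE] := normc_sqr a.
exists (2 * (r * k + l)) => [|u].
  by rewrite mulr_ge0 // addr_ge0 // mulr_ge0.
rewrite E; apply: le_trans (sqnD_le hdotP _ _) _.
rewrite -mulrA ler_wpM2l // mulrDl lerD //.
have -> : sq (a *: A u) = r * sq (A u).
  by apply: (@complexI R); rewrite real_complexM -!hnorm_sqn normrZ exprMn rE.
by rewrite -mulrA ler_wpM2l.
Qed.

Lemma adj_comp A B : bounded_op A -> bounded_op B -> adj (A \o B) = adj B \o adj A.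
Proof.
move=> bA bB; apply: adj_unique; first exact: bounded_op_comp.
by move=> u v /=; rewrite !adjE.
Qed.

Lemma adj_id : adj (id : op) = id.
Proof. by apply: adj_unique; first exact: bounded_op_id. Qed.

Lemma adj_lin a A B : bounded_op A -> bounded_op B ->
  adj (a *: A + B) = Num.conj a *: adj A + adj B.
Proof.
move=> bA bB; apply: adj_unique; first exact: bounded_op_lin.
move=> u v; rewrite (ipDr hdotP) (ipZr hdotP) conjCK -!adjE //.
exact: (ip_linear hdotP).
Qed.

(** Cauchy-Schwarz bounds the real part, and the imaginary part through ['i *: w]; hence the factor
    2 in [d], while the added one avoids division by zero. *)
Lemma hdot_small v (e : R[i]) : 0 < e ->
  exists2 d : R, 0 < d & forall w, sq w < d -> `|'[w, v]| < e.
Proof.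
move=> /gt0_complexE[r r0 ->].
have s0 := sqn_ge0 hdotP v.
have s1 : 0 < 2 * sq v + 1 by lra.
exists (r ^+ 2 / (2 * sq v + 1)); first by rewrite divr_gt0 ?exprn_gt0.
move=> w; rewrite ltr_pdivlMr // => hw.
rewrite -(@ltr_pXn2r _ 2%N) ?nnegrE ?normr_ge0 ?ler0c ?(ltW r0) //.
rewrite -add_Re2_Im2 -rmorphXn ltcR.
have h1 := Re_ip_sqr hdotP w v; have h2 := Re_ip_sqr hdotP ('i%C *: w) v.
have w0 := sqn_ge0 hdotP w.
move: h2; rewrite (ipZl hdotP) complex_ReM /= mul0r mul1r sub0r sqrrN.
have -> : sq ('i%C *: w) = sq w.
  by rewrite /sqn (ipZl hdotP) (ipZr hdotP) !(complex_ReM, complex_ImJ) /=; case: '[w, w] => x y /=; ring.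
by move=> h2; lra.
Qed.

End Adjoint.
Arguments hdotP {R} H.

(** * The bicommutant theorem *)

Section Commutants.
Context {R : realType} {H : hilbert R}.
Local Notation op := (H -> H).
Local Notation sq := (@sqn R H (hdot H)).
Implicit Types (A B T X : op) (S M N : set op) (u v : H).

Record star_algebra N : Prop := {
  sa_bounded : forall A, N A -> bounded_op A;
  sa_id : N id;
  sa_lin : forall (a : R[i]) A B, N A -> N B -> N (a *: A + B);
  sa_comp : forall A B, N A -> N B -> N (A \o B);
  sa_adj : forall A, N A -> N (adj A) }.

Definition star_closed S :=
  (forall A, S A -> bounded_op A) /\ (forall A, S A -> S (adj A)).

Lemma commutantS S S' : S `<=` S' -> commutant S' `<=` commutant S.
Proof. by move=> h T [bT hT]; split=> // A /h; exact: hT. Qed.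

Lemma sub_bicommutant S : (forall A, S A -> bounded_op A) ->
  S `<=` commutant (commutant S).
Proof. by move=> bS A SA; split=> [|B [_ hB]]; [exact: bS|rewrite hB]. Qed.

Lemma tricommutant S : (forall A, S A -> bounded_op A) ->
  commutant (commutant (commutant S)) = commutant S.
Proof.
move=> bS; apply/seteqP; split; first by apply: commutantS; exact: sub_bicommutant.
by apply: sub_bicommutant => A [].
Qed.

Lemma op_linE (a : R[i]) A B u : (a *: A + B) u = a *: A u + B u.
Proof. by []. Qed.

Lemma commutant_star_algebra S : star_closed S -> star_algebra (commutant S).
Proof.
move=> [bS aS]; split.
- by move=> A [].
- by split=> //; exact: bounded_op_id.
- move=> a A B [bA hA] [bB hB]; split; first exact: bounded_op_lin.
  move=> C SC; have [linC _] := bS _ SC; apply/funext => u /=.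
  rewrite op_linE.
  have := congr1 (@^~ u) (hA _ SC); have := congr1 (@^~ u) (hB _ SC) => /= -> ->.
  by rewrite -linC.
- move=> A B [bA hA] [bB hB]; split; first exact: bounded_op_comp.
  by move=> C SC; rewrite -compA (hB _ SC) compA (hA _ SC) compA.
- move=> A [bA hA]; split; first exact: bounded_adj.
  move=> C SC; have bC := bS _ SC; have SC' := aS _ SC.
  have := congr1 adj (hA _ SC').
  by rewrite (adj_comp bA (bS _ SC')) (adj_comp (bS _ SC') bA) (adjK bC) => ->.
Qed.

Lemma star_algebra_closed N : star_algebra N -> star_closed N.
Proof. by move=> [? _ _ _ ?]; split. Qed.

Lemma bicommutant_star_algebra S : star_closed S -> star_algebra (commutant (commutant S)).
Proof.
by move=> /commutant_star_algebra/star_algebra_closed/commutant_star_algebra.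
Qed.

(* The projection of [H ^ n] onto the closure of [N w] has matrix entries in
   [N'], hence commutes with [X]. *)
Lemma bicommutant_density N X n (w : 'I_n -> H) (e : R) :
  star_algebra N -> commutant (commutant N) X -> 0 < e ->
  exists2 B, N B & forall i, sq (B (w i) - X (w i)) < e.
Proof.
move=> saN [bX cX] e0.
have [bN idN linN compN adjN] := saN.
pose ip (f g : {ffun 'I_n -> H}) := \sum_i '[f i, g i].
have ipP : semi_inner ip.
  split=> [g a f f'|f g|f].
  - rewrite /ip mulr_sumr -big_split; apply: eq_bigr => i _ /=.
    by rewrite !ffunE (ip_linear (hdotP H)).
  - by rewrite /ip rmorph_sum; apply: eq_bigr => i _; rewrite (ip_herm (hdotP H)).
  - by apply: sumr_ge0 => i _; exact: (ip_ge0 (hdotP H)).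
pose sqV := @sqn R {ffun 'I_n -> H} ip.
have sqVE f : sqV f = \sum_i sq (f i).
  apply: (@complexI R); rewrite -(sqnE ipP) rmorph_sum /=.
  by apply: eq_bigr => i _; rewrite -(sqnE (hdotP H)).
have sqV_ge (f : {ffun 'I_n -> H}) i : sq (f i) <= sqV f.
  rewrite sqVE (bigD1 i) //= lerDl; apply: sumr_ge0 => j _.
  exact: (sqn_ge0 (hdotP H)).
(* [amp] is the diagonal action on the [n]-fold power of [H], and [K] the closure of the orbit of
   [wV] under [N]. *)
pose amp (A : op) (f : {ffun 'I_n -> H}) : {ffun 'I_n -> H} := [ffun i => A (f i)].
pose wV : {ffun 'I_n -> H} := [ffun i => w i].
pose K : set {ffun 'I_n -> H} := [set f | forall e : R, 0 < e -> exists2 B, N B & sqV (f - amp B wV) < e].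
have amp_lin A : bounded_op A -> linear (amp A).
  by move=> [linA _] a f g; apply/ffunP => i; rewrite !ffunE linA.
have zeroN : N (\0 : op).
  have := linN (-1) id id idN idN; congr N; apply/funext => u.
  by rewrite op_linE scaleN1r addNr.
have sqV00 : sqV 0 = 0 by rewrite /sqV /sqn (ip0l ipP).
have Ksub : lin_subspace K.
  split.
    move=> d d0; exists (\0 : op); first exact: zeroN.
    rewrite (_ : _ - _ = 0); first by rewrite sqV00.
    by apply/ffunP => i; rewrite !ffunE subrr.
  move=> a f g Kf Kg d d0; have [r r0 rE] := normc_sqr a.
  have d1 : 0 < d / (4 * (r + 1)) by rewrite divr_gt0 // mulr_gt0 // ltr_wpDl.
  have d4 : 0 < d / 4 by rewrite divr_gt0.
  have [B NB hB] := Kf _ d1; have [C NC hC] := Kg _ d4.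
  exists (a *: B + C); first exact: linN.
  rewrite (_ : _ - _ = a *: (f - amp B wV) + (g - amp C wV)); last first.
    by apply/ffunP => i; rewrite !ffunE op_linE opprD scalerBr addrACA.
  apply: le_lt_trans (sqnD_le ipP _ _) _.
  have -> : sqn (ip := ip) (a *: (f - amp B wV)) = r * sqV (f - amp B wV).
    apply: (@complexI R); rewrite real_complexM -rE -!(sqnE ipP).
    by rewrite (ipZl ipP) (ipZr ipP) mulrA -normCK.
  have : r * sqV (f - amp B wV) <= d / 4.
    apply: (@le_trans _ _ ((r + 1) * (d / (4 * (r + 1))))).
      apply: ler_pM => //; [exact: (sqn_ge0 ipP)|by rewrite lerDl|exact: ltW].
    by rewrite le_eqVlt; apply/orP; left; apply/eqP; field; rewrite gt_eqF // ltr_wpDl.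
  by rewrite /sqV in hC *; lra.
have Kclosed f : (forall d : R, 0 < d -> exists2 g, K g & sqV (g - f) < d) -> K f.
  move=> h d d0; have d4 : 0 < d / 4 by rewrite divr_gt0.
  have [g Kg hg] := h _ d4; have [B NB hB] := Kg _ d4.
  exists B => //; rewrite -(subrK g f) -addrA.
  apply: le_lt_trans (sqnD_le ipP _ _) _.
  by rewrite -(sqnN ipP (f - g)) opprB; rewrite /sqV in hB hg; lra.
have Kcomplete : seq_complete (ip := ip) K.
  move=> x Kx xc.
  have comp i : exists l, forall d : R, 0 < d -> exists m, forall k, (m <= k)%N -> sq (x k i - l) < d.
    have [//|d d0|l _ hl] := @hilbert_complete R H (fun k => x k i).
      have [m hm] := xc d d0; exists m => k k' mk mk'.
      by apply: le_lt_trans (hm k k' mk mk'); have := sqV_ge (x k - x k') i; rewrite !ffunE.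
    by exists l.
  pose l : {ffun 'I_n -> H} := [ffun i => projT1 (cid (comp i))].
  have hl i : forall d : R, 0 < d -> exists m, forall k, (m <= k)%N -> sq (x k i - l i) < d.
    by rewrite /l ffunE; case: cid.
  have lim d : 0 < d -> exists m, forall k, (m <= k)%N -> sqV (x k - l) < d.
    (* Dividing by [n.+1] covers [n = 0] and keeps the sum of [n] terms strictly below [d]. *)
    move=> d0; have dn : 0 < d / n.+1%:R by rewrite divr_gt0.
    pose m i := projT1 (cid (hl i _ dn)).
    have hm i k : (m i <= k)%N -> sq (x k i - l i) < d / n.+1%:R.
      by rewrite /m; case: cid => /= p hp; exact: hp.
    exists (\max_i m i) => k mk; rewrite sqVE.
    apply: (@le_lt_trans _ _ (\sum_(i < n) d / n.+1%:R)).
      apply: ler_sum => i _; rewrite [in sqn _]ffunE [X in x k i + X]ffunE.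
      apply: ltW; apply: hm.
      exact: leq_trans (leq_bigmax i) mk.
    rewrite sumr_const card_ord -[_ *+ n]mulr_natl mulrCA gtr_pMr //.
    by rewrite ltr_pdivrMr // mul1r ltr_nat.
  exists l => //; apply: Kclosed => d /lim[m hm].
  by exists (x m) => //; apply: hm.
(* The orthogonal projection of [f] to [K] is the Riesz vector of [ip ^~ f] on [K]. *)
have projP f : exists g, K g /\ forall h, K h -> ip h (f - g) = 0.
  have [a u v _ _|u _|g Kg hg] := @riesz_on_subspace R {ffun 'I_n -> H} ip ipP K
    (ip ^~ f) (sqV f) (sqn_ge0 ipP f) Ksub Kcomplete.
  - exact: (ip_linear ipP).
  - by rewrite mulrC; exact: (Re_ip_sqr ipP).
  by exists g; split=> // h Kh; rewrite (ipBr ipP) hg // subrr.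
pose P f := projT1 (cid (projP f)).
have KP f : K (P f) := (projT2 (cid (projP f))).1.
have PP f h : K h -> ip h (f - P f) = 0 := (projT2 (cid (projP f))).2 h.
have sqV0 f : sqV f = 0 -> f = 0.
  move=> f0; apply/ffunP => i; rewrite ffunE; refine (@sqn_eq0 R H _ _).
  by apply/eqP; rewrite eq_le (sqn_ge0 (hdotP H)) andbT -f0 sqV_ge.
have Puniq f g : K g -> (forall h, K h -> ip h (f - g) = 0) -> P f = g.
  move=> Kg hg; apply/eqP; rewrite -subr_eq0; apply/eqP; apply: sqV0.
  have Kd : K (P f - g).
    by rewrite addrC -scaleN1r; apply: Ksub.2.
  rewrite /sqV /sqn [X in ip _ X](_ : _ = (f - g) - (f - P f)); last first.
    by rewrite opprB [RHS]addrC addrA subrK.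
  by rewrite (ipBr ipP) hg // PP // subrr.
have Plin : linear P.
  move=> a f g; apply: Puniq; first exact: Ksub.2.
  move=> h Kh; rewrite opprD addrACA -scalerBr (ipDr ipP) (ipZr ipP).
  by rewrite !PP // mulr0 addr0.
have Pw : P wV = wV.
  apply: Puniq => [d d0|h _]; last by rewrite subrr -(subrr 0) (ipBr ipP) subrr.
  exists id; first exact: idN.
  rewrite (_ : _ - _ = 0); first by rewrite sqV00.
  by apply/ffunP => i; rewrite !ffunE subrr.
have Pbound f : sqV (P f) <= sqV f.
  have -> : f = P f + (f - P f) by rewrite addrC subrK.
  rewrite [P (_ + _)](_ : _ = P f); last by rewrite addrC subrK.
  by rewrite /sqV (sqnD ipP) PP // mulr0 addr0 lerDl (sqn_ge0 ipP).
have ampK B f : N B -> K f -> K (amp B f).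
  move=> NB Kf; have [linB [k k0 hk]] := (bounded_opP B).1 (bN _ NB).
  move=> d d0; have dk : 0 < d / (k + 1) by rewrite divr_gt0 // ltr_wpDl.
  have [C NC hC] := Kf _ dk; exists (B \o C); first exact: compN.
  have -> : amp B f - amp (B \o C) wV = amp B (f - amp C wV).
    apply/ffunP => i; rewrite !ffunE /=.
    by rewrite (zmod_morphism_linear linB).
  apply: (@le_lt_trans _ _ (k * sqV (f - amp C wV))).
    rewrite !sqVE mulr_sumr; apply: ler_sum => i _.
    by rewrite ffunE; exact: hk.
  apply: (@le_lt_trans _ _ ((k + 1) * sqV (f - amp C wV))).
    by rewrite ler_wpM2r ?lerDl // (sqn_ge0 ipP).
  by rewrite mulrC -ltr_pdivlMr // ltr_wpDl.
(* [K] is invariant under both [B] and [adj B], so its orthogonal complement is invariant too. *)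
have Pcomm B f : N B -> P (amp B f) = amp B (P f).
  move=> NB; have bB := bN _ NB; apply: Puniq; first exact: ampK.
  move=> h Kh.
  have -> : amp B f - amp B (P f) = amp B (f - P f).
    by rewrite (zmod_morphism_linear (amp_lin _ bB)).
  have -> : ip h (amp B (f - P f)) = ip (amp (adj B) h) (f - P f).
    apply: eq_bigr => i _; rewrite !ffunE adjE ?adjK //; exact: bounded_adj.
  by apply: PP; apply: ampK => //; exact: adjN.
pose inj (j : 'I_n) (u : H) : {ffun 'I_n -> H} := [ffun i => if i == j then u else 0].
pose Pij i j u := P (inj j u) i.
have inj_lin j : linear (inj j).
  move=> a u v; apply/ffunP => i; rewrite !ffunE; case: eqP => // _.
  by rewrite scaler0 addr0.
have cPij i j : commutant N (Pij i j).
  split.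
    apply/bounded_opP; split.
      by move=> a u v; rewrite /Pij inj_lin Plin !ffunE.
    exists 1 => // u; rewrite mul1r; apply: le_trans (sqV_ge _ _) _.
    apply: le_trans (Pbound _) _; rewrite sqVE (bigD1 j) //= big1 => [|i' /negbTE ne].
      by rewrite addr0 ffunE eqxx.
    by rewrite ffunE ne /sqn (ip0l (hdotP H)).
  move=> B NB; apply/funext => u /=; rewrite /Pij.
  have [linB _] := bN _ NB.
  have B0 : B 0 = 0 by rewrite -{1}(subrr 0) (zmod_morphism_linear linB) subrr.
  have -> : inj j (B u) = amp B (inj j u).
    by apply/ffunP => k; rewrite !ffunE; case: eqP => // _; rewrite B0.
  by rewrite Pcomm // ffunE.
have decomp (f : {ffun 'I_n -> H}) : f = \sum_j inj j (f j).
  apply/ffunP => i; rewrite sum_ffunE (bigD1 i) //= big1 => [|j /negbTE ne].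
    by rewrite addr0 ffunE eqxx.
  by rewrite ffunE eq_sym ne.
have P0 : P 0 = 0 by rewrite -{1}(subrr 0) (zmod_morphism_linear Plin) subrr.
have Psum f i : P f i = \sum_j Pij i j (f j).
  rewrite {1}(decomp f) (big_morph P (id1 := 0) (op1 := +%R)) //.
    by rewrite sum_ffunE.
  by move=> u v; rewrite -[u in LHS]scale1r Plin scale1r.
have [linX _] := bX.
have X0 : X 0 = 0 by rewrite -{1}(subrr 0) (zmod_morphism_linear linX) subrr.
(* [X] commutes with every entry of [P], and [P] fixes [wV]. Hence [amp X wV] lies in [K], which is
   the required approximation. *)
have PX : P (amp X wV) = amp X wV.
  apply/ffunP => i; rewrite Psum [RHS]ffunE -{2}Pw Psum.
  rewrite (big_morph X (id1 := 0) (op1 := +%R)) //.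
    apply: eq_bigr => j _; rewrite ffunE.
    by have := congr1 (@^~ (wV j)) (cX _ (cPij i j)) => /= ->.
  by move=> u v; rewrite -[u in LHS]scale1r linX scale1r.
have := KP (amp X wV); rewrite PX => /(_ _ e0)[B NB hB].
exists B => // i; apply: le_lt_trans hB.
have := sqV_ge (amp X wV - amp B wV) i; rewrite !ffunE.
by rewrite -(sqnN (hdotP H)) opprB.
Qed.

End Commutants.

(** * Transporters and the braiding *)

Section NetTheory.
Context {R : realType} {H : hilbert R}.
Local Notation op := (H -> H).
Local Notation region := (set (Mink R)).
Local Notation sq := (@sqn R H (hdot H)).
Local Notation "x %:C" := (real_complex _ x) : ring_scope.

(** * Norm closures and weak approximation *)

Lemma hnorm_leE (u v : H) (r : R) : 0 <= r -> (`|u| <= r%:C * `|v|) = (sq u <= r ^+ 2 * sq v).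
Proof.
move=> r0; rewrite -(@ler_pXn2r _ 2%N) ?nnegrE ?mulr_ge0 ?ler0c ?normr_ge0 //.
by rewrite exprMn !hnorm_sqn -rmorphXn -real_complexM lecR.
Qed.

Lemma norm_closure_star_closed (S : set op) : star_closed S -> star_closed (norm_closure S).
Proof.
move=> [bS aS]; split=> T [bT hT] //; split; first exact: bounded_adj.
move=> e e0; have [r r0 eE] := gt0_complexE e0.
have [X SX hX] := hT e e0; have bX := bS _ SX.
exists (adj X); first exact: aS.
have bD : bounded_op ((-1) *: X + T) by exact: bounded_op_lin.
have E u : T u - X u = ((-1) *: X + T) u by rewrite op_linE scaleN1r addrC.
have adjD u : adj T u - adj X u = adj ((-1) *: X + T) u.
  by rewrite adj_lin // rmorphN1 op_linE scaleN1r addrC.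
move=> u; rewrite eE hnorm_leE ?(ltW r0) // adjD.
apply: (adjoint_sqn_le (fun u v => adjE u v bD)) => v.
by rewrite -E -hnorm_leE ?(ltW r0) // -eE.
Qed.

Lemma norm_closure_sub (S : set op) : (forall X, S X -> bounded_op X) -> S `<=` norm_closure S.
Proof.
move=> bS X SX; split=> [|e e0]; first exact: bS.
by exists X => // u; rewrite subrr normr0 mulr_ge0 // ltW.
Qed.

Lemma norm_closureS (S S' : set op) : S `<=` S' -> norm_closure S `<=` norm_closure S'.
Proof. by move=> h T [bT hT]; split=> // e /hT[X /h]; exists X. Qed.

(** A weak neighbourhood tests finitely many pairs, so simultaneous strong approximation on their
    first components suffices. *)
Lemma bicommutant_weak_density (N : set op) X (s : seq (H * H)) (d : R[i]) :
  star_algebra N -> commutant (commutant N) X -> 0 < d ->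
  exists2 B, N B & forall w, w \in s -> `|'[B w.1 - X w.1, w.2]| < d.
Proof.
move=> saN NX d0.
have [e e0 he] : exists2 e : R, 0 < e &
    forall w z, w \in s -> sq z < e -> `|'[z, w.2]| < d.
  elim: s => [|w s [e e0 he]]; first by exists 1.
  have [e' e'0 he'] := hdot_small w.2 d0.
  exists (Num.min e e'); first by rewrite lt_min e0.
  move=> w' z; rewrite inE lt_min => /predU1P[->|w's] /andP[ze ze'].
    exact: he'.
  exact: he.
have [B NB hB] := bicommutant_density (fun i : 'I_(size s) => (nth (0, 0) s i).1) saN NX e0.
exists B => // w ws; apply: he => //.
have ilt : (index w s < size s)%N by rewrite index_mem.
by have := hB (Ordinal ilt); rewrite /= nth_index.
Qed.

Section Net.
Context {A : region -> set op} {U : Mink R -> op} {Omega : H}.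
Hypothesis net : observable_net A U Omega.

Lemma unitaryK (V : op) : unitary_op V -> cancel V (adj V).
Proof. by move=> [_ h _] u; exact: (congr1 (@^~ u) h). Qed.

Lemma unitaryKV (V : op) : unitary_op V -> cancel (adj V) V.
Proof. by move=> [_ _ h] u; exact: (congr1 (@^~ u) h). Qed.

(** * Local algebras and Haag duality *)

Lemma net_star_closed D : double_cone D -> star_closed (A D).
Proof. by move=> /(net_vN net)[aA E]; split=> X; [rewrite -E => -[]|exact: aA]. Qed.

Lemma algS S S' : S `<=` S' -> alg A S `<=` alg A S'.
Proof.
move=> h; apply: norm_closureS => X [D [dD DS] AX]; exists D => //.
by split=> //; exact: subset_trans h.
Qed.

Lemma net_unionP S X : (\bigcup_(D in [set D | double_cone D /\ D `<=` S]) A D) X ->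
  exists2 D, double_cone D & A D X.
Proof. by move=> [D [dD _] AX]; exists D. Qed.

Lemma alg_star_closed S : star_closed (alg A S).
Proof.
apply: norm_closure_star_closed; split=> X [D [dD DS] AX].
  exact: (net_star_closed dD).1.
by exists D => //; exact: (net_star_closed dD).2.
Qed.

Lemma alg_bounded S X : alg A S X -> bounded_op X.
Proof. exact: (alg_star_closed S).1. Qed.

Lemma net_sub_alg D S : double_cone D -> D `<=` S -> A D `<=` alg A S.
Proof.
move=> dD DS X AX; apply: norm_closure_sub; last by exists D.
by move=> Y /net_unionP[D' dD' AY]; exact: (net_star_closed dD').1.
Qed.

Lemma alg_quasilocal S : alg A S `<=` quasilocal A.
Proof. exact: algS. Qed.

Lemma net_quasilocal D : double_cone D -> A D `<=` quasilocal A.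
Proof. by move=> dD; exact: net_sub_alg. Qed.

Lemma spacelike_cone_commutant C : spacelike_cone C ->
  commutant (commutant (alg A (causal_compl C))) = commutant (alg A C).
Proof.
move=> /(haag_duality_spacelike_cone net) ->; apply: tricommutant => X.
exact: alg_bounded.
Qed.

Lemma double_cone_commutant D : double_cone D ->
  commutant (alg A (causal_compl D)) = A D.
Proof.
by move=> dD; rewrite (haag_duality_double_cone net dD) (net_vN net dD).2.
Qed.

Section Auxiliary.
Context {Sa : region}.

Lemma cone_vN_aux x : cone_vN A Sa x `<=` aux_alg A Sa.
Proof.
move=> X hX; apply: norm_closure_sub; last by exists x.
by move=> Y [z _ []].
Qed.

(* The operators [X] with [V E(X) = X V] form a *-algebra; by weak continuity
   it contains the bicommutant of any *-closed subset. *)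
Lemma extension_intertwines eta E (V : op) S x : extension A Sa eta E ->
  unitary_op V -> S `<=` causal_compl (translate Sa x) ->
  (forall X, alg A S X -> V \o eta X = X \o V) ->
  forall X, commutant (commutant (alg A S)) X -> V \o E X = X \o V.
Proof.
move=> [Erep Eeta Econt] VU SS hV.
have [bV _ _] := VU.
set M := commutant (commutant (alg A S)).
have saM : star_algebra M by apply: bicommutant_star_algebra; exact: alg_star_closed.
have Mcone X : M X -> cone_vN A Sa x X.
  by apply: commutantS; apply: commutantS; exact: algS.
have Maux X : M X -> aux_alg A Sa X by move=> /Mcone/cone_vN_aux.
have bE X : M X -> bounded_op (E X) by move=> /Maux; exact: (repr_bounded Erep).
pose N : set op := [set X | M X /\ V \o E X = X \o V].
have [linV _] := bV.
have saN : star_algebra N.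
  split.
  - by move=> X [MX _]; exact: (sa_bounded saM).
  - by split; [exact: (sa_id saM)|rewrite (repr_unit Erep)].
  - move=> a X Y [MX hX] [MY hY]; split; first exact: (sa_lin saM).
    rewrite (repr_linear Erep); try exact: Maux.
    apply/funext => u /=; rewrite !op_linE linV.
    by have := congr1 (@^~ u) hX; have := congr1 (@^~ u) hY => /= -> ->.
  - move=> X Y [MX hX] [MY hY]; split; first exact: (sa_comp saM).
    rewrite (repr_mul Erep); try exact: Maux.
    by rewrite compA hX -compA hY.
  - move=> X [MX hX]; split; first exact: (sa_adj saM).
    rewrite (repr_adj Erep); last exact: Maux.
    have bX := sa_bounded saM MX.
    have := congr1 adj hX; rewrite (adj_comp bV (bE _ MX)) (adj_comp bX bV) => h.
    apply/funext => u /=; rewrite -{1}(unitaryK VU u).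
    by have := congr1 (@^~ (V u)) h => /= ->; rewrite (unitaryKV VU).
have SN : alg A S `<=` N.
  move=> X hX; split; first by apply: sub_bicommutant hX => Y; exact: alg_bounded.
  by rewrite Eeta ?hV //; exact: alg_quasilocal hX.
move=> X MX.
have MNX : commutant (commutant N) X.
  exact: (commutantS (commutantS SN)) MX.
apply/funext => u /=.
apply/eqP; rewrite -subr_eq0; apply/eqP; apply: sqn_eq0.
set z := _ - _; rewrite /sqn.
suff -> : '[z, z] = 0 by [].
have [//|z0] := eqVneq '[z, z] 0.
have e0 : 0 < `|'[z, z]| by rewrite normr_gt0.
have [s [_ [/gt0_complexE[d d0 ->] hs]]] :=
  Econt x X u (adj V z) _ (Mcone _ MX) (divr_gt0 e0 (ltr0n _ 2)).
have /gt0_complexE[c c0 cE] := divr_gt0 e0 (ltr0n _ 2).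
have m0 : 0 < (Num.min d c)%:C by rewrite ltr0c lt_min d0.
(* One [B] in [N] serves two tests: the pairs [s] make [E B] close to [E X], and the pair [(V u, z)]
   makes [B] close to [X]. Each error is below half of ['[z, z]], a contradiction. *)
have [B [MB hB] near] := @bicommutant_weak_density N X ((V u, z) :: s) _ saN MNX m0.
have h1 : `|'[E B u - E X u, adj V z]| < `|'[z, z]| / 2.
  apply: hs => [|w ws]; first exact: Mcone.
  have := near w; rewrite inE ws orbT => /(_ isT)/lt_le_trans; apply.
  by rewrite lecR ge_min lexx.
have h2 : `|'[B (V u) - X (V u), z]| < `|'[z, z]| / 2.
  have := near (V u, z); rewrite mem_head => /(_ isT)/lt_le_trans; apply.
  by rewrite cE lecR ge_min lexx orbT.
have zE : '[z, z] = - '[E B u - E X u, adj V z] + '[B (V u) - X (V u), z].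
  rewrite -(adjE _ _ bV) -(ipNl (hdotP H)) -(ipDl (hdotP H)) (zmod_morphism_linear linV).
  have := congr1 (@^~ u) hB => /= ->.
  by rewrite opprB addrA subrK.
have : `|'[z, z]| < `|'[z, z]| / 2 + `|'[z, z]| / 2.
  by rewrite [X in X < _](congr1 Num.norm zE); apply: le_lt_trans (ler_normD _ _) _; rewrite normrN ltrD.
by rewrite -splitr ltxx.
Qed.

(* [V] intertwines [f] with [V f(.) V^*], which is localised in [S]. *)
Definition transporter (f : op -> op) S (V : op) : Prop :=
  unitary_op V /\ forall X, alg A (causal_compl S) X -> V \o f X = X \o V.

Lemma transporterS f S S' V : S `<=` S' -> transporter f S V -> transporter f S' V.
Proof.
move=> h [VU hV]; split=> // X hX; apply: hV; apply: algS hX.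
exact: causal_complS.
Qed.

Lemma transporter_id f S : localised A S f -> transporter f S id.
Proof.
move=> h; split=> [|X /h -> //].
by split; rewrite ?adj_id //; exact: bounded_op_id.
Qed.

Lemma Hom_transporter f g S V : Defs.Hom A f g V -> unitary_op V -> localised A S g ->
  transporter f S V.
Proof.
move=> [_ h] VU gS; split=> // X hX; rewrite h ?gS //; exact: alg_quasilocal hX.
Qed.

(** Both unitaries turn [f] into the identity on the algebra of the complement of [S]. Through Haag
    duality this localises [V \o adj W] in [S]. *)
Lemma transporter_commutant f S V W : transporter f S V -> transporter f S W ->
  commutant (alg A (causal_compl S)) (V \o adj W).
Proof.
move=> [VU hV] [WU hW]; have [bV _ _] := VU; have [bW _ _] := WU.
split; first exact: bounded_op_comp (bounded_adj bW).
move=> X hX; apply/funext => u /=.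
rewrite -{1}(unitaryKV WU u).
have := congr1 (@^~ (adj W u)) (hW X hX) => /= <-.
by rewrite (unitaryK WU); exact: (congr1 (@^~ (adj W u)) (hV X hX)).
Qed.

Lemma DHR_transporter D0 D rho : DHR_endomorphism A D0 rho -> double_cone D ->
  exists V, transporter rho D V.
Proof.
move=> [_ _ h] /h[rhoh [_ rhohD [V VU hV]]]; exists V; split=> // X hX.
by rewrite hV ?rhohD //; exact: alg_quasilocal hX.
Qed.

(** The identity is also a transporter of [f], so in a double cone containing [D] and [D'] duality
    applies to [V \o adj id]. *)
Lemma transporter_local f D D' V : localised A D f -> double_cone D ->
  double_cone D' -> transporter f D' V -> exists2 D'', double_cone D'' & A D'' V.
Proof.
move=> fD dD dD' hV; have [D'' dD'' DD''] := double_cone_bigger dD dD'.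
exists D'' => //; rewrite -(double_cone_commutant dD'').
have h1 : transporter f D'' id.
  by apply: (transporterS _ (transporter_id fD)) => y ?; apply: DD''; left.
have h2 : transporter f D'' V.
  by apply: (transporterS _ hV) => y ?; apply: DD''; right.
by have := transporter_commutant h2 h1; rewrite adj_id.
Qed.

Lemma net_aux S D : spacelike_cone Sa -> S !=set0 -> S `<=` causal_compl Sa ->
  double_cone D -> A D `<=` aux_alg A Sa.
Proof.
move=> Sac S0 SSa dD; have [x Dx] := double_cone_in_translate_compl Sac S0 SSa dD.
move=> X AX; apply: (@cone_vN_aux x); apply: sub_bicommutant.
  by move=> Y; exact: alg_bounded.
exact: net_sub_alg AX.
Qed.

(** Independence of the transporter and of its double cone. Within one double cone, [W' = Z \o W]
    with [Z] local and spacelike to [C], so [V1 \o eta Z = Z \o V1] and [Z] cancels. *)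
Lemma transporter_transfer eta rho D0 C V1 D D' V V' :
  representation (quasilocal A) eta -> DHR_endomorphism A D0 rho -> double_cone D0 ->
  spacelike_cone C -> transporter eta C V1 ->
  double_cone D -> double_cone D' ->
  D `<=` causal_compl C -> D' `<=` causal_compl C ->
  transporter rho D V -> transporter rho D' V' ->
  adj V' \o (V1 \o eta V') = adj V \o (V1 \o eta V).
Proof.
move=> eta_rep rho_DHR dD0 Cc hV1 dD dD' DC D'C hV hV'.
have [_ rho_loc _] := rho_DHR.
pose P (D : region) := forall W, transporter rho D W ->
  adj W \o (V1 \o eta W) = adj V \o (V1 \o eta V).
have transfer E W W' : double_cone E -> E `<=` causal_compl C ->
    transporter rho E W -> transporter rho E W' ->
    adj W' \o (V1 \o eta W') = adj W \o (V1 \o eta W).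
  move=> dE EC hW hW'; pose Z := W' \o adj W.
  have AZ : A E Z.
    by rewrite -(double_cone_commutant dE); exact: (transporter_commutant hW' hW).
  have [E' dE' AW] := transporter_local rho_loc dD0 dE hW.
  have W'E : W' = Z \o W.
    by apply/funext => u; rewrite /Z /= (unitaryK hW.1).
  have etaW' : eta W' = eta Z \o eta W.
    rewrite {1}W'E (repr_mul eta_rep) //.
      exact: net_quasilocal AZ.
    exact: net_quasilocal AW.
  have VZ : V1 \o eta Z = Z \o V1 by apply: hV1.2; exact: net_sub_alg AZ.
  apply/funext => u /=; rewrite etaW' /=.
  have := congr1 (@^~ (eta W u)) VZ => /= ->.
  by rewrite /Z /= (unitaryK hW'.1).
(* A transporter into [E] is also one into [E'], where [transfer] compares it with any other. *)
have Pmono E E' : double_cone E -> double_cone E' -> E `<=` E' ->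
    E' `<=` causal_compl C -> P E <-> P E'.
  move=> dE dE' EE' E'C; split=> PE W hW; last by apply: PE; exact: (transporterS EE' hW).
  have [Z hZ] := DHR_transporter rho_DHR dE.
  by rewrite -(PE Z hZ); exact: (transfer E' _ _ dE' E'C (transporterS EE' hZ) hW).
apply: (causal_compl_connected Cc Pmono dD dD' DC D'C) hV' => W hW.
exact: (transfer D V W dD DC hV hW).
Qed.

(* The right-hand side does not remember the cones [C1] and [C2], in particular
   not their order: hence the degeneracy. *)
Lemma braiding_transporter eta rho Eeta Erho O C C1 C2 x y D V V1 V2 :
  spacelike_cone Sa -> O `<=` causal_compl Sa -> double_cone O ->
  representation (quasilocal A) eta -> localised A C eta ->
  DHR_endomorphism A O rho ->
  extension A Sa eta Eeta -> extension A Sa rho Erho ->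
  spacelike_cone C1 -> spacelike_cone C2 ->
  C2 `<=` causal_compl C1 -> C2 `<=` causal_compl (translate Sa x) ->
  transporter eta C1 V1 -> transporter rho C2 V2 ->
  C `<=` causal_compl (translate Sa y) -> C1 `<=` causal_compl (translate Sa y) ->
  double_cone D -> D `<=` translate Sa y -> transporter rho D V ->
  adj (tensor_mor V2 Erho V1) \o tensor_mor V1 Eeta V2 = adj V \o eta V.
Proof.
move=> Sac OSa dO eta_rep eta_loc rho_DHR eta_ext rho_ext C1c C2c C21 C2x hV1 hV2.
move=> Cy C1y dD Dy hV.
have [_ rho_loc _] := rho_DHR.
have [V1U hV1'] := hV1; have [V2U hV2'] := hV2; have [VU hV'] := hV.
have [bV1 _ _] := V1U; have [bV2 _ _] := V2U; have [bV _ _] := VU.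
have [Eeta_rep Eeta_eta _] := eta_ext; have [Erho_rep Erho_rho _] := rho_ext.
have yC1 : translate Sa y `<=` causal_compl C1 by exact: sub_causal_complC.
(* Both localisation cones [C] and [C1] are spacelike to the translated auxiliary cone, so [V1]
   commutes with the algebra of that cone; duality does the rest. *)
have V1y : cone_vN A Sa y V1.
  rewrite /cone_vN (spacelike_cone_commutant (spacelike_cone_translate y Sac)).
  split=> // X hX.
  rewrite -hV1'; last exact: algS hX.
  congr (_ \o _); rewrite eta_loc //; apply: algS hX; exact: sub_causal_complC.
have V1aux := cone_vN_aux V1y.
have bErho : bounded_op (Erho V1) by exact: (repr_bounded Erho_rep).
(* Since [D] lies in the translated auxiliary cone, [V] undoes [rho] on the algebra of its
   complement, and weak continuity extends this to [V1]. *)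
have rhoV1 : V \o Erho V1 = V1 \o V.
  have hS X : alg A (causal_compl (translate Sa y)) X -> V \o rho X = X \o V.
    by move=> hX; apply: hV'; apply: algS hX; exact: causal_complS.
  exact: (extension_intertwines rho_ext VU (@subset_refl _ _) hS).
(* [V3] is local, whereas [V2] only lies in the auxiliary algebra. *)
have [D2 dD2 D2C2] := spacelike_cone_double C2c.
have [V3 hV3] := DHR_transporter rho_DHR dD2.
have [V3U _] := hV3.
pose W := V2 \o adj V3.
have WC2 : commutant (commutant (alg A C2)) W.
  rewrite -(haag_duality_spacelike_cone net C2c).
  exact: (transporter_commutant hV2 (transporterS D2C2 hV3)).
have etaW : V1 \o Eeta W = W \o V1.
  have hS X : alg A C2 X -> V1 \o eta X = X \o V1.
    by move=> hX; apply: hV1'; exact: algS hX.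
  exact: (extension_intertwines eta_ext V1U C2x hS).
have Waux : aux_alg A Sa W.
  apply: (@cone_vN_aux x); move: W WC2 {etaW}; apply: commutantS; apply: commutantS.
  (* Here [C2] lies in the complement of the auxiliary cone translated by [x]. *)
  exact: algS.
have [D3 dD3 AV3] := transporter_local rho_loc dO dD2 hV3.
have V3aux : aux_alg A Sa V3.
  exact: (net_aux Sac (double_cone_neq0 dO) OSa dD3).
have EetaV2 : Eeta V2 = Eeta W \o eta V3.
  rewrite -(Eeta_eta V3); last exact: net_quasilocal AV3.
  rewrite -(repr_mul Eeta_rep) //; congr Eeta; apply/funext => u.
  by rewrite /W /= (unitaryK V3U).
(* As [V2 = W \o V3] and [V1] carries [Eeta W] to [W], the factor [W] cancels. *)
have eq1 : adj V2 \o (V1 \o Eeta V2) = adj V3 \o (V1 \o eta V3).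
  apply/funext => u; rewrite EetaV2 /=.
  have := congr1 (@^~ (eta V3 u)) etaW => /= ->.
  by rewrite /W /= (unitaryK V2U).
have eq2 := transporter_transfer eta_rep rho_DHR dO C1c hV1 dD dD2
  (subset_trans Dy yC1) (subset_trans D2C2 C21) hV hV3.
have eq3 : adj (Erho V1) \o adj V = adj V \o adj V1.
  by rewrite -(adj_comp bV bErho) rhoV1 adj_comp.
rewrite /tensor_mor (adj_comp bV2 bErho).
apply/funext => u /=.
have := congr1 (@^~ u) eq1 => /= ->.
have := congr1 (@^~ u) eq2 => /= ->.
have := congr1 (@^~ (V1 (eta V u))) eq3 => /= ->.
by rewrite (unitaryK V1U).
Qed.
End Auxiliary.
End Net.
End NetTheory.

Theorem lemma2p14 (R : realType) (H : hilbert R)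
    (A : set (Mink R) -> set (H -> H)) (U : Mink R -> H -> H) (Omega : H)
    (Sa C O : set (Mink R)) (eta rho : (H -> H) -> (H -> H)) :
  observable_net A U Omega ->
  spacelike_cone Sa ->
  spacelike_cone C ->
  (exists x : Mink R, C `<=` causal_compl (translate Sa x)) ->
  Delta_BF A Sa C eta ->
  double_cone O ->
  O `<=` causal_compl Sa ->
  Delta_DHR A O rho ->
  forall eps_rho_eta eps_eta_rho : H -> H,
    is_braiding A Sa rho eta eps_rho_eta ->
    is_braiding A Sa eta rho eps_eta_rho ->
    eps_rho_eta \o eps_eta_rho = id.
Proof.
move=> net Sac _ [x0 Cx0] [[eta_rep _] eta_loc _] dO OSa [rho_DHR _] e1 e2.
move=> [Erho [Eeta [C1 [C2 [x [rhoh [etah [V1 [V2 [[rho_ext eta_ext]]]]]]]]]]].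
move=> [C1c C2c [C21 _]]; rewrite subUset => -[C1x C2x].
move=> [_ rhohC1 hV1 V1U V1aux] [_ etahC2 hV2 V2U V2aux] ->.
move=> [Eeta' [Erho' [C1' [C2' [x' [etah' [rhoh' [V1' [V2' [[eta_ext' rho_ext']]]]]]]]]]].
move=> [C1c' C2c' [C21' _]]; rewrite subUset => -[C1x' C2x'].
move=> [_ etahC1' hV1' V1U' _] [_ rhohC2' hV2' V2U' _] ->.
(* A translate of [Sa] inside those by [x0], [x] and [x'] is spacelike to [C], [C2] and [C1'] at
   once, so a single [V] computes both braidings. *)
have [y1 y1x0 y1x] := spacelike_cone_translate_sub x0 x Sac.
have [y yy1 yx'] := spacelike_cone_translate_sub y1 x' Sac.
have Cy : C `<=` causal_compl (translate Sa y).
  by apply: (subset_trans Cx0); apply: causal_complS; exact: subset_trans y1x0.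
have C2y : C2 `<=` causal_compl (translate Sa y).
  by apply: (subset_trans C2x); apply: causal_complS; exact: subset_trans y1x.
have C1y' : C1' `<=` causal_compl (translate Sa y).
  by apply: (subset_trans C1x'); exact: causal_complS.
have [D dD Dy] := spacelike_cone_double (spacelike_cone_translate y Sac).
have [V hV] := DHR_transporter rho_DHR dD.
have [[VU _] [_ rho_loc _]] := (hV, rho_DHR).
have [D' dD' AV] := transporter_local net rho_loc dO dD hV.
have AV' : A D' (adj V) by exact: (net_star_closed net dD').2.
have qV := net_quasilocal net dD' AV; have qV' := net_quasilocal net dD' AV'.
have [bV _ _] := VU; have bV' := bounded_adj bV.
have beV : bounded_op (eta V) by exact: (repr_bounded eta_rep).
rewrite (braiding_transporter net Sac OSa dO eta_rep eta_loc rho_DHR eta_ext' rho_ext'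
  C1c' C2c' C21' C2x' (Hom_transporter hV1' V1U' etahC1') (Hom_transporter hV2' V2U' rhohC2')
  Cy C1y' dD Dy hV).
(* With the cones exchanged, the formula for [eta] and [rho] yields the adjoint of the braiding of
   [rho] and [eta], which is therefore [eta (adj V) \o V]. *)
have C12 : C1 `<=` causal_compl C2 by exact: sub_causal_complC.
have := braiding_transporter net Sac OSa dO eta_rep eta_loc rho_DHR eta_ext rho_ext
  C2c C1c C12 C1x (Hom_transporter hV2 V2U etahC2) (Hom_transporter hV1 V1U rhohC1)
  Cy C2y dD Dy hV.
have bX : bounded_op (tensor_mor V1 Erho V2).
  apply: bounded_op_comp; first by case: V1U.
  by have [Er _ _] := rho_ext; exact: (repr_bounded Er).
have bY : bounded_op (tensor_mor V2 Eeta V1).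
  apply: bounded_op_comp; first by case: V2U.
  by have [Er _ _] := eta_ext; exact: (repr_bounded Er).
move=> /(congr1 adj); rewrite (adj_comp (bounded_adj bX) bY) (adjK bX) => ->.
rewrite (adj_comp bV' beV) (adjK bV) -(repr_adj eta_rep) //.
apply/funext => u /=; rewrite (unitaryKV VU).
have : eta (adj V) \o eta V = id.
  rewrite -(repr_mul eta_rep) //; have [_ -> _] := VU.
  exact: (repr_unit eta_rep).
by move=> /(congr1 (@^~ u)).
Qed.
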